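(* Let $D\ge 1$ and $r\ge 3$ be integers. For the Hamming graph $H(D,r)$, let $W$ denote an irreducible $\mathbb{T}$-module with diameter $d$. Then for $-D \leq s \leq D$ the following are equivalent: (i) $\mathbb{F}_{s}W \neq 0$; (ii) $-d \leq s \leq d$ and $d-s$ is even. Moreover, if (i) and (ii) hold, then $\dim (\mathbb{F}_{s}W) = 1$.
   Context: Let $X$ be a set with $|X|=r$. The Hamming graph $H(D,r)$ has vertex set $\mathbb{X}=X\times\cdots\times X$ ($D$ factors), with two vertices adjacent whenever they differ in precisely one coordinate; it is distance-regular with diameter $D$. Let $\partial$ denote its path-length distance, and let $\mathbb{V}=\mathbb{C}^{\mathbb{X}}$. Matrices are complex, with rows and columns indexed by $\mathbb{X}$, and act on $\mathbb{V}$ by left multiplication. For $0\le i\le D$ the $i$th distance matrix $\mathbb{A}_i$ has $(y,z)$-entry $1$ if $\partial(y,z)=i$ and $0$ otherwise. The primitive idempotents $\mathbb{E}_0,\ldots,\mathbb{E}_D$ are taken in the standard $Q$-polynomial ordering: $\mathbb{E}_i$ is the matrix of the orthogonal projection of $\mathbb{V}$ onto the eigenspace of $\mathbb{A}_1$ with eigenvalue $(r-1)D-ri$. Fix $x\in X$ and let $\mathbf{x}=(x,x,\ldots,x)\in\mathbb{X}$. For $0\le i\le D$, the $i$th dual idempotent $\mathbb{E}_i^*$ is the diagonal matrix with $(y,y)$-entry $1$ if $\partial(\mathbf{x},y)=i$ and $0$ otherwise, and the $i$th dual distance matrix $\mathbb{A}_i^*$ is the diagonal matrix with $(y,y)$-entry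 $r^D(\mathbb{E}_i)_{\mathbf{x}y}$. It is known that $\mathbb{A}_D$ and $\mathbb{A}_D^*$ are invertible. The subconstituent algebra $\mathbb{T}$ is the subalgebra of the full matrix algebra generated by $\mathbb{A}_0,\ldots,\mathbb{A}_D,\mathbb{A}_0^*,\ldots,\mathbb{A}_D^*$. A $\mathbb{T}$-module is a subspace $W\subseteq\mathbb{V}$ with $BW\subseteq W$ for all $B\in\mathbb{T}$; it is irreducible if it is nonzero and contains no $\mathbb{T}$-modules other than $0$ and $W$. The diameter of an irreducible $\mathbb{T}$-module $W$ is $|\{i\mid 0\le i\le D,\ \mathbb{E}_i^*W\ne 0\}|-1$. The matrix $\mathbb{A}_{D}^{-1}\mathbb{A}_{D}^{*-1}\mathbb{A}_{D}\mathbb{A}_{D}^{*}$ is diagonalizable with eigenvalues $(1-r)^s$, $-D\le s\le D$. For $-D\le s\le D$, $\mathbb{F}_s$ denotes the projection of $\mathbb{V}$ onto the eigenspace of this matrix for the eigenvalue $(1-r)^s$, along the sum of its other eigenspaces; thus $\mathbb{F}_s\mathbb{F}_t=\delta_{st}\mathbb{F}_s$, $\sum_s\mathbb{F}_s=I$ and $\mathbb{A}_{D}^{-1}\mathbb{A}_{D}^{*-1}\mathbb{A}_{D}\mathbb{A}_{D}^{*}=\sum_s(1-r)^s\mathbb{F}_s$. *)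

(* Defs.v *)
From HB Require Import structures.
From mathcomp Require Import all_boot all_order all_algebra.
From mathcomp Require Import spectral.

Set Implicit Arguments.
Unset Strict Implicit.
Unset Printing Implicit Defensive.

Import Order.TTheory GRing.Theory Num.Theory.
Local Open Scope ring_scope.

Section GraphDistance.
Variables (T : finType) (e : rel T).

Definition walk (n : nat) (y z : T) : bool :=
  [exists p : n.-tuple T, path e y p && (last y p == z)].

(* A shortest walk has fewer than #|T| edges, so the search range loses
   nothing; the value is #|T| when z is not reachable from y. *)
Definition graph_dist (y z : T) : nat :=
  find (fun n => walk n y z) (iota 0 #|T|).

End GraphDistance.

(* Vectors are columns and matrices act on the left, whereas eigenspace,
   proj_ortho and proj_mx speak of row vectors: hence the transpositions. *)
Section ColumnActions.
Variables (C : numClosedFieldType) (n : nat).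
Implicit Types (A M U V : 'M[C]_n) (W : {vspace 'cV[C]_n}).

(* The rows of ceigenspace A a span the u^T with A *m u = a *: u. *)
Definition ceigenspace A (a : C) : 'M[C]_n := eigenspace A^T a.

(* U and V are given by their row spaces, as in ceigenspace. *)
Definition cproj_ortho U : 'M[C]_n := (proj_ortho U)^T.

Definition cproj U V : 'M[C]_n := (proj_mx U V)^T.

Definition mximg A W : {vspace 'cV[C]_n} := (linfun (mulmx A) @: W)%VS.

Inductive gen_alg (S : 'M[C]_n -> Prop) : 'M[C]_n -> Prop :=
| gen_alg_in A of S A : gen_alg S A
| gen_alg1 : gen_alg S 1%:M
| gen_algZ a A of gen_alg S A : gen_alg S (a *: A)
| gen_algD A B of gen_alg S A & gen_alg S B : gen_alg S (A + B)
| gen_algM A B of gen_alg S A & gen_alg S B : gen_alg S (A *m B).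

Definition is_module (T : 'M[C]_n -> Prop) W : Prop :=
  forall B, T B -> (mximg B W <= W)%VS.

Definition irreducible_module (T : 'M[C]_n -> Prop) W : Prop :=
  [/\ W <> 0%VS, is_module T W &
      forall U : {vspace 'cV[C]_n},
        is_module T U -> (U <= W)%VS -> U = 0%VS \/ U = W].

End ColumnActions.

Section Hamming.
Variables (C : numClosedFieldType) (D : nat) (X : finType).

Local Notation r := #|X|.

Definition vertex : finType := {ffun 'I_D -> X}.

Local Notation N := #|vertex|.

Definition hamming_adj : rel vertex :=
  fun y z => #|[set k : 'I_D | y k != z k]| == 1%N.

Definition hdist : vertex -> vertex -> nat := graph_dist hamming_adj.

(* Vertices index matrices through enum_val : 'I_N -> vertex. *)
Definition dist_mx (i : nat) : 'M[C]_N :=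
  \matrix_(j, k) (hdist (enum_val j) (enum_val k) == i)%:R.

Definition hamming_eig (i : nat) : C := (r%:R - 1) * D%:R - r%:R * i%:R.

Definition prim_idem (i : nat) : 'M[C]_N :=
  cproj_ortho (ceigenspace (dist_mx 1) (hamming_eig i)).

Variable x : X.

Definition base_vertex : vertex := [ffun=> x].

Definition dual_idem (i : nat) : 'M[C]_N :=
  diag_mx (\row_j (hdist base_vertex (enum_val j) == i)%:R).

Definition dual_dist_mx (i : nat) : 'M[C]_N :=
  diag_mx (\row_j (r%:R ^+ D * prim_idem i (enum_rank base_vertex) j)).

Definition subconstituent_alg : 'M[C]_N -> Prop :=
  gen_alg (fun B => exists2 i : nat, (i <= D)%N &
    B = dist_mx i \/ B = dual_dist_mx i).

Definition module_diam (W : {vspace 'cV[C]_N}) : nat :=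
  (#|[set i : 'I_D.+1 | mximg (dual_idem i) W != 0%VS]| - 1)%N.

Definition comm_mx_D : 'M[C]_N :=
  invmx (dist_mx D) *m invmx (dual_dist_mx D) *m dist_mx D *m dual_dist_mx D.

Definition comm_eigenspace (s : int) : 'M[C]_N :=
  ceigenspace comm_mx_D ((1 - r%:R) ^ s).

(* Projection along the sum of the other eigenspaces: t - D runs over the
   integers of [-D, D], and the (1 - r) ^ (t - D) are distinct for r >= 3. *)
Definition comm_proj (s : int) : 'M[C]_N :=
  cproj (comm_eigenspace s)
    (\sum_(t < (2 * D).+1 | t%:Z - D%:Z != s) comm_eigenspace (t%:Z - D%:Z))%MS.

End Hamming.

Arguments dist_mx C D X i : clear implicits.
Arguments prim_idem C D X i : clear implicits.
Arguments dual_idem C D {X} x i.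
Arguments dual_dist_mx C D {X} x i.
Arguments subconstituent_alg C D {X} x _.
Arguments module_diam {C D X} x W.
Arguments comm_proj C D {X} x s.

(* Main.v *)
(* In M_r(C), indexed by X, let e = J / r with J the all-ones matrix, and let s
   be the diagonal projection onto x; with q = 1 / r these idempotents satisfy
   e s e = q e and s e s = q s, so they generate a copy of M_2 + C, in which c
   denotes the unit of M_2. Let P, Q, K be the sums over the D coordinates of
   e, s, c. Then A_1 = r P - D, every A_i is a polynomial in P, every A_i^* is a
   polynomial in Q, and conversely P and Q lie in T, so that the T-modules are
   the subspaces stable under P and Q. On an irreducible module W the central
   element K is a scalar, hence W is irreducible under the Lie algebra sl_2 of
   trace zero elements of M_2 acting by sums over the coordinates: for any
   sl_2-triple (h, e', f'), h has simple eigenvalues m, m - 2, ..., -m on W,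
   where m + 1 = dim W.
   For h = 2 s - c this gives the eigenvalues of Q on W, whence m = d. On the
   other hand A_D^-1 A_D^*-1 A_D A_D^* is the D-th tensor power of
   (1 - r) p + (1 - r)^-1 p' + (1 - c), where p projects onto the line of x
   along the constant vectors inside the M_2-block, and p' = c - p. It is thus
   (1 - r)^h for the triple with h = p - p', and F_s W is the eigenspace of this
   h in W for the eigenvalue s. *)

From HB Require Import structures.
Require Import Defs.
From mathcomp Require Import all_boot all_order all_algebra.
From mathcomp Require Import reals complex.
From mathcomp Require Import spectral ring zify.
Import Order.TTheory GRing.Theory Num.Theory.
Local Open Scope ring_scope.

Set Implicit Arguments.
Unset Strict Implicit.
Unset Printing Implicit Defensive.

(** * Stable subspaces and representations of sl_2 *)

Section StableSubspaces.
Variables (C : numClosedFieldType) (n : nat).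
Implicit Types (A B H E F : 'M[C]_n) (U W : {vspace 'cV[C]_n}) (v w : 'cV[C]_n).

Definition stable A U := forall v, v \in U -> A *m v \in U.

Lemma mem_mximg A U v : v \in U -> A *m v \in mximg A U.
Proof. by move=> Uv; rewrite -[A *m v](lfunE (mulmx A)) memv_img. Qed.

Lemma mximgP A U w : reflect (exists2 v, v \in U & w = A *m v) (w \in mximg A U).
Proof.
apply: (iffP memv_imgP) => -[v Uv ->]; exists v => //; by rewrite lfunE.
Qed.

Lemma stableP A U : (mximg A U <= U)%VS <-> stable A U.
Proof.
split=> [/subvP sAU v Uv | sAU]; first exact/sAU/mem_mximg.
by apply/subvP=> w /mximgP[v Uv ->]; apply: sAU.
Qed.

Lemma stable1 U : stable 1%:M U.
Proof. by move=> v; rewrite mul1mx. Qed.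

Lemma stableD A B U : stable A U -> stable B U -> stable (A + B) U.
Proof. by move=> sA sB v Uv; rewrite mulmxDl memvD ?sA ?sB. Qed.

Lemma stableZ a A U : stable A U -> stable (a *: A) U.
Proof. by move=> sA v Uv; rewrite -scalemxAl memvZ ?sA. Qed.

Lemma stableB A B U : stable A U -> stable B U -> stable (A - B) U.
Proof. by move=> sA sB; rewrite -scaleN1r; apply/stableD/stableZ. Qed.

Lemma stableM A B U : stable A U -> stable B U -> stable (A *m B) U.
Proof. by move=> sA sB v Uv; rewrite -mulmxA; apply/sA/sB. Qed.

Lemma stable_sum I (r : seq I) (P : pred I) (A : I -> 'M[C]_n) U :
  (forall i, P i -> stable (A i) U) -> stable (\sum_(i <- r | P i) A i) U.
Proof.
move=> sA; elim/big_rec: _ => [v _|i B Pi]; first by rewrite mul0mx mem0v.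
by apply/stableD/sA.
Qed.

Lemma stable_prod I (r : seq I) (P : pred I) (A : I -> 'M[C]_n) U :
  (forall i, P i -> stable (A i) U) -> stable (\prod_(i <- r | P i) A i) U.
Proof.
move=> sA; elim/big_rec: _ => [|i B Pi]; first exact: stable1.
by apply/stableM/sA.
Qed.

Lemma stable_eigenvector A U : U <> 0%VS -> stable A U ->
  exists a, exists2 v, v \in U & v != 0 /\ A *m v = a *: v.
Proof.
move=> /eqP U0 sAU; pose b := vbasis U.
have Ub i : b`_i \in U.
  have [ltiU|leUi] := ltnP i (size b); first exact/vbasis_mem/mem_nth.
  by rewrite nth_default // mem0v.
(* Row [i] of [M] holds the coordinates of the image of the [i]-th basis vector, so a row
   eigenvector of [M] is the coordinate vector of an eigenvector of [A] in [U]. *)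
pose M := \matrix_(i < \dim U, j < \dim U) coord b j (A *m b`_i).
have [|a /eigenvalueP[u uM u0]] := @eigenvalue_closed C _ M.
  by rewrite lt0n dimv_eq0.
exists a, (\sum_i u 0 i *: b`_i).
  by apply: rpred_sum => i _; rewrite memvZ.
split.
  apply: contraNneq u0 => sum0; apply/eqP/rowP=> i; rewrite mxE.
  by have /freeP/(_ (fun i => u 0 i) sum0 i) := basis_free (vbasisP U).
transitivity (\sum_j (u *m M) 0 j *: b`_j); last first.
  by rewrite uM scaler_sumr; apply: eq_bigr => j _; rewrite mxE scalerA.
under [RHS]eq_bigr => j _ do rewrite mxE scaler_suml.
rewrite exchange_big mulmx_sumr /=; apply: eq_bigr => i _.
rewrite -scalemxAr {1}(coord_vbasis (sAU _ (Ub i))) scaler_sumr.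
by apply: eq_bigr => j _; rewrite mxE scalerA.
Qed.

Lemma prod_sub_eigenvector A v a I (r : seq I) (P : pred I) (c : I -> C) :
    A *m v = a *: v ->
  (\prod_(i <- r | P i) (A - (c i)%:M)) *m v
    = (\prod_(i <- r | P i) (a - c i)) *: v.
Proof.
move=> Av; elim/big_rec2: _ => [|i b B _ IH]; first by rewrite mul1mx scale1r.
rewrite -mulmxA IH -scalemxAr mulmxBl Av mul_scalar_mx -scalerBl scalerA.
by rewrite mulrC.
Qed.

(** In a vanishing combination, the product of the [A - (a j)%:M] over [j != i] kills every term
    except the [i]-th, which it multiplies by a nonzero scalar. *)
Lemma eigenvectors_free A m (v : m.-tuple 'cV[C]_n) (a : 'I_m -> C) :
    injective a -> (forall i : 'I_m, v`_i != 0 /\ A *m v`_i = a i *: v`_i) ->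
  free v.
Proof.
move=> inj_a Av; apply/freeP=> k sum0 i; apply/eqP.
pose B := \prod_(j | j != i) (A - (a j)%:M).
have := congr1 (mulmx B) sum0; rewrite mulmx0 mulmx_sumr (bigD1 i) //= big1.
  rewrite addr0 -scalemxAr (prod_sub_eigenvector _ _ _ (Av i).2).
  move/eqP; rewrite !scaler_eq0 (negPf (Av i).1) orbF => /orP[] //.
  case/prodf_eq0=> j neji; rewrite subr_eq0 => /eqP/inj_a eqij.
  by rewrite eqij eqxx in neji.
move=> j neji; rewrite -scalemxAr (prod_sub_eigenvector _ _ _ (Av j).2).
by rewrite (bigD1 j) //= subrr mul0r scale0r scaler0.
Qed.

Lemma iter_ladder A F (d a : C) v k :
    A *m F - F *m A = d *: F -> A *m v = a *: v ->
  A *m iter k (mulmx F) v = (a + d *+ k) *: iter k (mulmx F) v.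
Proof.
move=> AF Av; elim: k => [|k IHk] /=; first by rewrite addr0.
move/eqP: AF; rewrite subr_eq => /eqP AF.
rewrite mulmxA AF mulmxDl -scalemxAl -mulmxA IHk -scalemxAr -scalerDl.
by rewrite mulrS addrCA.
Qed.

(** The eigenvalues [a + d *+ j] are pairwise distinct, so nonzero vectors of the string are
    independent and one of the first [n.+1] must vanish. *)
Lemma ladder_top A F (d a : C) v :
    A *m F - F *m A = d *: F -> d != 0 -> A *m v = a *: v -> v != 0 ->
  exists2 k, (forall j, (j <= k)%N -> iter j (mulmx F) v != 0)
           & iter k.+1 (mulmx F) v = 0.
Proof.
move=> AF d0 Av v0; pose w k := iter k (mulmx F) v.
have [k wk0] : exists k, w k == 0.
  have [/existsP[k wk0]|/existsPn/= wn0] := boolP [exists k : 'I_n.+1, w k == 0].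
    by exists k.
  have free_w : free [tuple w i | i < n.+1].
    apply: (@eigenvectors_free A _ _ (fun i => a + d *+ i)) => [i j|i].
      move/addrI=> eq_d; have : d *+ i == d *+ j by rewrite eq_d.
      rewrite -[d *+ i]mulr_natr -[d *+ j]mulr_natr (inj_eq (mulfI d0)) eqr_nat.
      by move/eqP/val_inj.
    rewrite (_ : _`_i = w i); first by rewrite wn0 (iter_ladder _ AF Av).
    by rewrite -tnth_nth tnth_mktuple.
  have := dimvS (subvf <<[tuple w i | i < n.+1]>>%VS).
  by rewrite (eqP free_w) size_tuple dimvf /dim /= muln1 ltnn.
case: (ex_minnP (ex_intro (fun k => w k == 0) k wk0)) => -[|m] wm0 min_m.
  by rewrite /w /= (negPf v0) in wm0.
exists m; last exact/eqP.
by move=> j lejm; apply: contraTneq lejm => wj0; rewrite -ltnNge min_m ?[w j]wj0.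
Qed.

(** The highest weight argument: a vector killed by [E] generates under [F] a finite string whose
    span [H], [E] and [F] preserve, and irreducibility makes this span equal to [W]. *)
Lemma sl2_irreducible_basis H E F W :
    H *m E - E *m H = 2 *: E -> H *m F - F *m H = - 2 *: F ->
    E *m F - F *m E = H ->
    W <> 0%VS -> stable H W -> stable E W -> stable F W ->
    (forall U, (U <= W)%VS -> U <> 0%VS ->
       stable H U -> stable E U -> stable F U -> U = W) ->
  exists m, exists2 b : m.+1.-tuple 'cV[C]_n, basis_of W b
    & forall j : 'I_m.+1, H *m b`_j = (m%:R - 2 * j%:R) *: b`_j.
Proof.
move=> HE HF EF W0 sH sE sF irrW.
have [a0 [v0 Wv0 [v00 Hv0]]] := stable_eigenvector W0 sH.
have two0 : (2 : C) != 0 by rewrite pnatr_eq0.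
have iterW G k u : stable G W -> u \in W -> iter k (mulmx G) u \in W.
  by move=> sG Wu; elim: k => //= k IHk; apply: sG.
(* Climbing with [E] from any eigenvector of [H] ends at a highest weight vector [v]. *)
have [k nz_k Ek0] := ladder_top HE two0 Hv0 v00.
set v := iter k (mulmx E) v0; set a := a0 + 2 *+ k.
have Hv : H *m v = a *: v by apply: iter_ladder HE Hv0.
have Wv : v \in W by apply: iterW.
have Ev : E *m v = 0 by [].
have vn0 : v != 0 by apply: nz_k.
have twoN0 : (- 2 : C) != 0 by rewrite oppr_eq0.
have [m nz_m Fm0] := ladder_top HF twoN0 Hv vn0.
pose w i := iter i (mulmx F) v.
have Hw i : H *m w i = (a - 2 * i%:R) *: w i.
  by rewrite (iter_ladder _ HF Hv) mulNrn mulr_natr.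
have EFw i : E *m w i.+1 = (i.+1%:R * (a - i%:R)) *: w i.
  have EFl u : E *m (F *m u) = H *m u + F *m (E *m u).
    by rewrite -EF mulmxBl !mulmxA subrK.
  have wS l : w l.+1 = F *m w l by [].
  elim: i => [|i IHi]; rewrite wS EFl.
    by rewrite -[w 0%N]/v Ev Hv mulmx0 addr0 mul1r subr0.
  rewrite IHi Hw -scalemxAr -wS -scalerDl; congr (_ *: _).
  by rewrite -(natr1 i.+1) -(natr1 i); ring.
(* Applying [E] to [F^(m+1) v = 0] gives [(m+1) (a - m) F^m v = 0], where [F^m v] is nonzero. *)
have a_m : a = m%:R.
  have /eqP := EFw m; rewrite [w m.+1]Fm0 mulmx0 eq_sym scaler_eq0.
  by rewrite (negPf (nz_m m (leqnn m))) orbF mulf_eq0 pnatr_eq0 subr_eq0 => /eqP.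
pose b := [tuple w i | i < m.+1].
have bE (i : 'I_m.+1) : b`_i = w i by rewrite -tnth_nth tnth_mktuple.
have Hb (j : 'I_m.+1) : H *m b`_j = (m%:R - 2 * j%:R) *: b`_j.
  by rewrite bE Hw a_m.
exists m, b => //.
have free_b : free b.
  apply: (eigenvectors_free (A := H) (a := fun j => m%:R - 2 * j%:R)) => [i j|j].
    by move/addrI/oppr_inj/(mulfI two0)/eqP; rewrite eqr_nat => /eqP/val_inj.
  by rewrite Hb bE; split=> //; apply: nz_m; rewrite -ltnS.
rewrite basisEfree free_b.
have b_w l : (l <= m)%N -> w l \in <<b>>%VS.
  move=> lem; have ltm : (l < m.+1)%N by [].
  by rewrite -[l]/(val (Ordinal ltm)) -bE memv_span ?mem_nth ?size_tuple.
suff eqW : <<b>>%VS = W by rewrite -eqW subvv (eqP free_b) leqnn.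
have span_stable G : (forall i, (i <= m)%N -> G *m w i \in <<b>>%VS) ->
    stable G <<b>>%VS.
  move=> Gw u /coord_span ->; rewrite mulmx_sumr; apply: rpred_sum => i _.
  by rewrite -scalemxAr memvZ // bE Gw // -ltnS.
apply: irrW.
- apply/span_subvP=> u /(nthP 0)[l]; rewrite size_tuple => ltm <-.
  by rewrite -[l]/(val (Ordinal ltm)) bE iterW.
- apply/eqP; apply: contraNneq vn0 => b0; rewrite -memv0 -b0.
  exact: (b_w 0%N).
- by apply: span_stable => i lim; rewrite Hw memvZ ?b_w.
- apply: span_stable => -[|i] lim; first by rewrite Ev mem0v.
  by rewrite EFw memvZ // b_w // ltnW.
- apply: span_stable => i; rewrite leq_eqVlt => /predU1P[->|lim].
    by rewrite -[F *m _]/(w m.+1) [w m.+1]Fm0 mem0v.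
  exact: (b_w i.+1).
Qed.

(** Lagrange interpolation: the product of the [A - (a i)%:M] over [i != j] equals [P j] up to a
    nonzero scalar. *)
Lemma stable_spectral_idem (J : finType) A (P : J -> 'M[C]_n) (a : J -> C) U j :
    injective a -> \sum_i P i = 1%:M -> (forall i, A *m P i = a i *: P i) ->
  stable A U -> stable (P j) U.
Proof.
move=> inj_a sumP AP sA v Uv.
pose B := \prod_(i | i != j) (A - (a i)%:M).
pose c := \prod_(i | i != j) (a j - a i).
have c0 : c != 0.
  apply/prodf_neq0=> i neij; rewrite subr_eq0; apply: contra_neq neij.
  by move/inj_a.
have APv i : A *m (P i *m v) = a i *: (P i *m v).
  by rewrite mulmxA AP scalemxAl.
suff BE : B *m v = c *: (P j *m v).
  rewrite -[P j *m v]scale1r -(mulVf c0) -scalerA -BE memvZ //.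
  apply: stable_prod Uv => i _; apply: stableB => //.
  by rewrite -scalemx1; apply/stableZ/stable1.
rewrite -{1}[v]mul1mx -sumP mulmx_suml mulmx_sumr (bigD1 j) //= big1.
  by rewrite addr0 (prod_sub_eigenvector _ _ _ (APv j)).
move=> i neij; rewrite (prod_sub_eigenvector _ _ _ (APv i)).
by rewrite (bigD1 i) //= subrr mul0r scale0r.
Qed.

End StableSubspaces.

(** * Tensor powers of matrices *)

Section TensorMatrices.
Variables (C : numClosedFieldType) (D : nat) (X : finType).
Local Notation N := #|vertex D X|.
Implicit Types (a b : 'M[C]_#|X|) (f g : 'I_D -> 'M[C]_#|X|) (v : 'cV[C]_N).

Definition site (i : 'I_N) (k : 'I_D) : 'I_#|X| := enum_rank (enum_val i k).

(** The Kronecker product with one factor per coordinate, read through the encodings of vertices and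
    of elements of [X] as ordinals. *)
Definition tensmx f : 'M[C]_N :=
  \matrix_(i, j) \prod_k f k (site i k) (site j k).

Lemma eq_tensmx f g : f =1 g -> tensmx f = tensmx g.
Proof. by move=> fg; apply/matrixP=> i j; rewrite !mxE; under eq_bigr do rewrite fg. Qed.

Lemma site_inj i j : site i =1 site j -> i = j.
Proof.
move=> eq_ij; apply: enum_val_inj; apply/ffunP=> k.
exact/enum_rank_inj/eq_ij.
Qed.

Lemma prod_site_eq i j : \prod_k (site i k == site j k)%:R = (i == j)%:R :> C.
Proof.
have [->|neq_ij] := eqVneq; first by rewrite big1 // => k _; rewrite eqxx.
have [k neqk] : exists k, site i k != site j k.
  apply/existsP; apply: contraNT neq_ij => /existsPn eq_ij.
  by apply/eqP/site_inj => k; apply/eqP; move: (eq_ij k); rewrite negbK.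
by rewrite (bigD1 k) //= (negPf neqk) mul0r.
Qed.

Lemma tensmx1 : tensmx (fun=> 1%:M) = 1%:M.
Proof.
apply/matrixP=> i j; rewrite !mxE -prod_site_eq.
by apply: eq_bigr => k _; rewrite mxE.
Qed.

Lemma tensmxM f g : tensmx f *m tensmx g = tensmx (fun k => f k *m g k).
Proof.
apply/matrixP=> i j; rewrite !mxE.
under [RHS]eq_bigr => k _ do
  rewrite mxE (reindex _ (onW_bij _ (enum_rank_bij X))) /=.
rewrite bigA_distr_bigA /= (reindex _ (onW_bij _ (enum_val_bij (vertex D X)))) /=.
by apply: eq_bigr => l _; rewrite !mxE -big_split.
Qed.

Lemma tensmxZ (c : 'I_D -> C) f :
  tensmx (fun k => c k *: f k) = (\prod_k c k) *: tensmx f.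
Proof.
apply/matrixP=> i j; rewrite !mxE -big_split.
by apply: eq_bigr => k _; rewrite mxE.
Qed.

Lemma tensmx_sum (J : finType) (f : 'I_D -> J -> 'M[C]_#|X|) :
  tensmx (fun k => \sum_j f k j)
    = \sum_(phi : {ffun 'I_D -> J}) tensmx (fun k => f k (phi k)).
Proof.
apply/matrixP=> i j; rewrite summxE !mxE.
under eq_bigr => k _ do rewrite summxE.
by rewrite bigA_distr_bigA; apply: eq_bigr => phi _; rewrite mxE.
Qed.

Lemma tensmxD f g :
  tensmx (fun k => f k + g k)
    = \sum_(S : {set 'I_D}) tensmx (fun k => if k \in S then f k else g k).
Proof.
apply/matrixP=> i j; rewrite summxE !mxE.
under eq_bigr => k _ do rewrite mxE.
rewrite bigA_distr; apply: eq_bigr => S _; rewrite mxE.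
by apply: eq_bigr => k _; case: ifP.
Qed.

Lemma tensmx_tr f : (tensmx f)^T = tensmx (fun k => (f k)^T).
Proof. by apply/matrixP=> i j; rewrite !mxE; apply: eq_bigr => k _; rewrite mxE. Qed.

Definition coordmx (k : 'I_D) a := tensmx (fun l => if l == k then a else 1%:M).

(** The Lie algebra action on the tensor power, where [a] acts as a derivation. *)
Definition derivmx a := \sum_k coordmx k a.

Lemma coordmx_lin k (c : C) a b :
  coordmx k (c *: a + b) = c *: coordmx k a + coordmx k b.
Proof.
apply/matrixP=> i j; rewrite !mxE !(bigD1 (P := predT) k) //= !eqxx !mxE.
rewrite mulrDl mulrA; congr (_ * _ + _ * _);
  by apply: eq_bigr => l /negPf->.
Qed.

Lemma coordmxM k a b : coordmx k a *m coordmx k b = coordmx k (a *m b).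
Proof.
rewrite tensmxM; apply: eq_tensmx => l; case: ifP => // _; exact: mulmx1.
Qed.

Lemma coordmxC k l a b : k != l ->
  coordmx k a *m coordmx l b = coordmx l b *m coordmx k a.
Proof.
move=> nekl; rewrite !tensmxM; apply: eq_tensmx => m.
have [->|_] := eqVneq m k; last by rewrite mul1mx mulmx1.
by rewrite (negPf nekl) mul1mx mulmx1.
Qed.

Lemma coordmx_mul k a f :
  coordmx k a *m tensmx f = tensmx (fun l => if l == k then a *m f l else f l).
Proof.
by rewrite tensmxM; apply: eq_tensmx => l; case: ifP => // _; rewrite mul1mx.
Qed.

Lemma derivmx_lin (c : C) a b : derivmx (c *: a + b) = c *: derivmx a + derivmx b.
Proof.
rewrite /derivmx scaler_sumr -big_split; apply: eq_bigr => k _.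
exact: coordmx_lin.
Qed.

Lemma derivmx0 : derivmx 0 = 0.
Proof. by have := derivmx_lin (-1) 0 0; rewrite scaleN1r oppr0 addr0 scaleN1r addNr. Qed.

Lemma derivmxZ (c : C) a : derivmx (c *: a) = c *: derivmx a.
Proof. by rewrite -[c *: a]addr0 derivmx_lin derivmx0 addr0. Qed.

Lemma derivmxD a b : derivmx (a + b) = derivmx a + derivmx b.
Proof. by rewrite -[a]scale1r derivmx_lin !scale1r. Qed.

Lemma derivmxB a b : derivmx (a - b) = derivmx a - derivmx b.
Proof. by rewrite derivmxD -scaleN1r derivmxZ scaleN1r. Qed.

Lemma derivmx1 : derivmx 1%:M = D%:R%:M.
Proof.
rewrite /derivmx (eq_bigr (fun=> 1%:M)) => [|k _]; last first.
  by rewrite -tensmx1; apply: eq_tensmx => l; case: ifP.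
by rewrite sumr_const card_ord -scaler_nat scalemx1.
Qed.

(** Matrices placed at different coordinates commute, so only the terms with equal coordinates
    survive in the commutator. *)
Lemma derivmx_bracket a b :
  derivmx a *m derivmx b - derivmx b *m derivmx a = derivmx (a *m b - b *m a).
Proof.
rewrite derivmxB /derivmx !mulmx_suml.
under eq_bigr => k _ do rewrite mulmx_sumr.
under [X in _ - X]eq_bigr => k _ do rewrite mulmx_sumr.
rewrite [X in _ - X]exchange_big -!sumrB; apply: eq_bigr => k _ /=.
rewrite -sumrB (bigD1 k) //= big1 => [|l nelk]; first by rewrite addr0 !coordmxM.
by rewrite (coordmxC _ _ nelk) subrr.
Qed.

Lemma derivmx_tens a f (c : 'I_D -> C) : (forall k, a *m f k = c k *: f k) ->
  derivmx a *m tensmx f = (\sum_k c k) *: tensmx f.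
Proof.
move=> af; rewrite mulmx_suml scaler_suml; apply: eq_bigr => k _.
rewrite coordmx_mul (eq_tensmx (g := fun l => (if l == k then c k else 1) *: f l)).
  by rewrite tensmxZ -big_mkcond big_pred1_eq.
by move=> l; case: eqP => [->|_]; rewrite ?af ?scale1r.
Qed.

(** * Weights of a sum over the coordinates and its exponential *)

Section IntegerWeights.
Variables (J : finType) (p : J -> 'M[C]_#|X|) (wt : J -> int).
Hypothesis p_idem : forall i j, p i *m p j = if i == j then p i else 0.
Hypothesis sum_p : \sum_j p j = 1%:M.

(** Choosing one idempotent per coordinate splits the tensor power into components of weight
    [\sum_k wt (phi k)] under [derivmx h]. *)
Let pi (phi : {ffun 'I_D -> J}) := tensmx (fun k => p (phi k)).

Lemma sum_mul_idem (c : J -> C) j : (\sum_i c i *: p i) *m p j = c j *: p j.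
Proof.
rewrite mulmx_suml (bigD1 j) //= big1 => [|i neij].
  by rewrite addr0 -scalemxAl p_idem eqxx.
by rewrite -scalemxAl p_idem (negPf neij) scaler0.
Qed.

Lemma mul_idem_sum (c : J -> C) j : p j *m (\sum_i c i *: p i) = c j *: p j.
Proof.
rewrite mulmx_sumr (bigD1 j) //= big1 => [|i neij].
  by rewrite addr0 -scalemxAr p_idem eqxx.
by rewrite -scalemxAr p_idem eq_sym (negPf neij) scaler0.
Qed.

Let h := \sum_j (wt j)%:~R *: p j.

Let sum_pi : \sum_phi pi phi = 1%:M.
Proof. by rewrite -(tensmx_sum (fun=> p)) -tensmx1; apply: eq_tensmx. Qed.

Let derivmx_pi phi :
  pi phi *m derivmx h = (\sum_k wt (phi k))%:~R *: pi phi.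
Proof.
rewrite mulmx_sumr rmorph_sum /= scaler_suml; apply: eq_bigr => k _.
rewrite tensmxM (eq_tensmx (g := fun l =>
  (if l == k then (wt (phi k))%:~R else 1) *: p (phi l))).
  by rewrite tensmxZ -big_mkcond big_pred1_eq.
by move=> l; case: eqP => [->|_]; rewrite ?mul_idem_sum ?scale1r ?mulmx1.
Qed.

Let weight_pi phi (c : C) v : derivmx h *m v = c *: v -> pi phi *m v != 0 ->
  c = (\sum_k wt (phi k))%:~R.
Proof.
move=> hv piv; have /eqP := congr1 (mulmx (pi phi)) hv.
rewrite mulmxA derivmx_pi -scalemxAl -scalemxAr -subr_eq0 -scalerBl scaler_eq0.
by rewrite (negPf piv) orbF subr_eq0 => /eqP.
Qed.

(** Some component [pi phi *m v] is nonzero, and its weight must be the eigenvalue of [v]. *)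
Lemma derivmx_eigenvalue (c : C) v : derivmx h *m v = c *: v -> v != 0 ->
  exists phi : {ffun 'I_D -> J}, c = (\sum_k wt (phi k))%:~R.
Proof.
move=> hv; rewrite -{1}[v]mul1mx -sum_pi mulmx_suml => v0.
have [/existsP[phi piv]|/existsPn pi0] := boolP [exists phi, pi phi *m v != 0].
  by exists phi; apply: weight_pi piv.
rewrite big1 ?eqxx // in v0 => phi _; apply/eqP; move: (pi0 phi).
by rewrite negbK.
Qed.

(** The tensor power of [z ^ h] is [z] raised to [derivmx h]: only components of total weight [s]
    occur in [v], and on each of them the factors of the coordinates multiply to [z ^ s]. *)
Lemma tensmx_exp_derivmx (z : C) (s : int) v : z != 0 ->
    derivmx h *m v = s%:~R *: v ->
  tensmx (fun=> \sum_j z ^ wt j *: p j) *m v = z ^ s *: v.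
Proof.
move=> z0 hv; rewrite -{1}[v]mul1mx -{2}[v]mul1mx -sum_pi !mulmx_suml mulmx_sumr.
rewrite scaler_sumr; apply: eq_bigr => phi _.
have [->|piv] := eqVneq (pi phi *m v) 0; first by rewrite mulmx0 scaler0.
have /eqP := weight_pi hv piv; rewrite eqr_int => /eqP->.
rewrite mulmxA tensmxM.
rewrite (eq_tensmx (g := fun k => z ^ wt (phi k) *: p (phi k))); last first.
  by move=> k; rewrite sum_mul_idem.
rewrite tensmxZ -scalemxAl; congr (_ *: _).
by elim/big_rec2: _ => // k s' y _ ->; rewrite expfzDr.
Qed.

End IntegerWeights.

(** * Elementary symmetric sums over sets of coordinates *)

Section ElementarySymmetric.

(* The coefficient of [t ^ i] in the tensor power of [b + t a]. *)
Definition esymmx i a b : 'M[C]_N :=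
  \sum_(S : {set 'I_D} | #|S| == i) tensmx (fun k => if k \in S then a else b).

(** In the expanded product, [S] is the set of coordinates that contribute a factor ['X]. *)
Lemma sum_card_prod (c d : 'I_D -> C) i :
  \sum_(S : {set 'I_D} | #|S| == i) \prod_k (if k \in S then c k else d k)
    = (\prod_k (c k *: 'X + (d k)%:P))`_i.
Proof.
rewrite bigA_distr coef_sum big_mkcond /=; apply: eq_bigr => S _.
rewrite (eq_bigr (fun k => (if k \in S then 'X else 1)
   * (if k \in S then c k else d k)%:P)); last first.
  by move=> k _; case: ifP => _; rewrite ?mul1r // -mul_polyC mulrC.
rewrite big_split /= -big_mkcond /= prodr_const -rmorph_prod /= coefMC coefXn.
by rewrite eq_sym; case: eqP; rewrite ?mul1r ?mul0r.
Qed.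

Lemma esymmxE i a b j k :
  esymmx i a b j k
    = (\prod_l (a (site j l) (site k l) *: 'X + (b (site j l) (site k l))%:P))`_i.
Proof.
rewrite -sum_card_prod summxE; apply: eq_bigr => S _; rewrite mxE.
by apply: eq_bigr => l _; case: ifP.
Qed.

Lemma card_coords (S : {set 'I_D}) : (#|S| <= D)%N.
Proof. by have := max_card (mem S); rewrite card_ord. Qed.

Lemma esymmx_full a b : esymmx D a b = tensmx (fun=> a).
Proof.
rewrite /esymmx (big_pred1 [set: 'I_D]) => [|S].
  by apply: eq_tensmx => k; rewrite inE.
by rewrite /= eqEcard subsetT cardsT card_ord eqn_leq card_coords.
Qed.

Lemma esymmx0 a b : esymmx 0 a b = tensmx (fun=> b).
Proof.
rewrite /esymmx (big_pred1 set0) => [|S]; last by rewrite cards_eq0.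
by apply: eq_tensmx => k; rewrite inE.
Qed.

Lemma esymmx1 a : esymmx 1 a 1%:M = derivmx a.
Proof.
rewrite /esymmx (eq_bigl (fun S => S \in [set [set k] | k : 'I_D])) => [|S].
  rewrite big_imset => [|k l _ _]; last exact: set1_inj.
  by apply: eq_bigr => k _; apply: eq_tensmx => l; rewrite inE.
by apply/cards1P/imsetP => [[k ->]|[k _ ->]]; exists k.
Qed.

Lemma sum_esymmx a b : \sum_(i < D.+1) esymmx i a b = tensmx (fun=> a + b).
Proof.
rewrite tensmxD (partition_big (fun S : {set 'I_D} => inord #|S| : 'I_D.+1) predT) //=.
apply: eq_bigr => i _; apply: eq_bigl => S.
by rewrite -val_eqE /= inordK // ltnS card_coords.
Qed.

Lemma esymmx_tr i a b : (esymmx i a b)^T = esymmx i a^T b^T.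
Proof.
rewrite /esymmx linear_sum; apply: eq_bigr => S _ /=; rewrite tensmx_tr.
by apply: eq_tensmx => k; case: ifP.
Qed.

Lemma derivmx_tr a : (derivmx a)^T = derivmx a^T.
Proof. by rewrite -!esymmx1 esymmx_tr trmx1. Qed.

Lemma prod_card_if (S : {set 'I_D}) (R : comNzRingType) (y z : R) :
  \prod_k (if k \in S then y else z) = y ^+ #|S| * z ^+ (D - #|S|).
Proof.
rewrite (bigID (mem S)) /= (eq_bigr (fun=> y)) => [|k ->//].
rewrite [X in _ * X](eq_bigr (fun=> z)) => [|k /negPf->//].
rewrite !prodr_const; congr (_ * _ ^+ _).
have := cardC (mem S); rewrite card_ord => cS.
by apply/eqP; rewrite -(eqn_add2l #|S|) subnKC ?card_coords //; apply/eqP.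
Qed.

Section TwoTermIdempotent.
Variables (e e' : 'M[C]_#|X|).
Hypothesis (ee : e *m e = e) (ee' : e *m e' = 0).

Lemma derivmx_esymmx j : derivmx e *m esymmx j e e' = j%:R *: esymmx j e e'.
Proof.
rewrite mulmx_sumr scaler_sumr; apply: eq_bigr => S /eqP <-.
rewrite (derivmx_tens (c := fun k => (k \in S)%:R)) => [|k].
  by rewrite -natr_sum -big_mkcond sum1_card.
by case: ifP => _; rewrite ?ee ?ee' ?scale1r ?scale0r.
Qed.

(** Each summand on the right has [j] factors [e] and [D - j] factors [e'], on which [1 + t a] acts
    by [1 + t y] and [1 + t z]; the eigenvalue is the coefficient of [t ^ i]. *)
Lemma esymmx_mul i j a (y z : C) : a *m e = y *: e -> a *m e' = z *: e' ->
  esymmx i a 1%:M *m esymmx j e e'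
    = ((y *: 'X + 1) ^+ j * (z *: 'X + 1) ^+ (D - j))`_i *: esymmx j e e'.
Proof.
move=> ae ae'; rewrite mulmx_sumr scaler_sumr; apply: eq_bigr => S /eqP <-.
rewrite -prod_card_if mulmx_suml.
rewrite (eq_bigr (fun T : {set 'I_D} => (\prod_k (if k \in T then
  if k \in S then y else z else 1)) *: tensmx (fun k => if k \in S then e else e'))).
  rewrite -scaler_suml sum_card_prod polyC1; congr (nth 0 (polyseq _) _ *: _).
  by apply: eq_bigr => k _; case: ifP.
move=> T _; rewrite tensmxM -tensmxZ; apply: eq_tensmx => k.
by do 2!case: ifP => _; rewrite ?mul1mx ?scale1r.
Qed.

End TwoTermIdempotent.

End ElementarySymmetric.

End TensorMatrices.

(** * The Hamming distance *)

Section HammingDistance.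
Variables (D : nat) (X : finType).
Implicit Types y z w : vertex D X.

Definition ndiff y z : nat := #|[set k | y k != z k]|.

Lemma ndiff_eq0 y z : (ndiff y z == 0%N) = (y == z).
Proof.
apply/eqP/eqP => [/eqP|->]; last by apply: eq_card0 => k; rewrite !inE eqxx.
rewrite cards_eq0 => /eqP yz0; apply/ffunP=> k.
by have := in_set0 k; rewrite -yz0 inE => /negbFE/eqP.
Qed.

Lemma ndiff_triangle z y w : (ndiff y w <= ndiff y z + ndiff z w)%N.
Proof.
apply: leq_trans (leq_card_setU _ _).1; apply/subset_leq_card/subsetP => k.
by rewrite !inE -negb_and; apply: contra => /andP[/eqP-> /eqP->].
Qed.

Lemma ndiff_leq y z : (ndiff y z <= D)%N.
Proof. by have := max_card (mem [set k | y k != z k]); rewrite card_ord. Qed.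

Lemma path_ndiff y p : path (@hamming_adj D X) y p ->
  (ndiff y (last y p) <= size p)%N.
Proof.
elim: p y => [|z p IHp] y /=; first by rewrite leqn0 ndiff_eq0.
case/andP=> /eqP yz /IHp; rewrite -(leq_add2l 1%N) -[X in (X + _)%N]yz.
exact/leq_trans/ndiff_triangle.
Qed.

Lemma ex_path_ndiff y z : exists2 p,
  path (@hamming_adj D X) y p /\ last y p = z & size p = ndiff y z.
Proof.
move: {2}(ndiff y z) (erefl (ndiff y z)) => m.
elim: m y => [|m IHm] y yz.
  by exists [::]; rewrite ?yz //=; split=> //; apply/eqP; rewrite -ndiff_eq0 yz.
have [k] : exists k, k \in [set k | y k != z k].
  by apply/card_gt0P; rewrite -[#|_|]/(ndiff y z) yz.
(* Correcting one differing coordinate gives a neighbour of [y] that is closer to [z] by one. *)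
rewrite inE => neqk; pose w : vertex D X := [ffun l => if l == k then z k else y l].
have wz : ndiff w z = m.
  apply/eqP; rewrite -eqSS -yz /ndiff [X in _ == X](cardsD1 k) inE neqk add1n eqSS.
  apply/eqP/eq_card => l; rewrite !inE ffunE.
  by case: (l =P k) => [->|//]; rewrite eqxx.
have [p [path_p last_p] size_p] := IHm w wz.
exists (w :: p); rewrite /= ?size_p ?wz //; split=> //; rewrite path_p andbT.
apply/cards1P; exists k; apply/setP=> l; rewrite !inE ffunE.
by case: (l =P k) => [->|_]; rewrite ?eqxx // (negPf neqk).
Qed.

Lemma card_vertex : #|vertex D X| = (#|X| ^ D)%N.
Proof. by have := card_ffun 'I_D X; rewrite card_ord. Qed.

Lemma hdistE y z : (1 < #|X|)%N -> hdist y z = ndiff y z.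
Proof.
move=> r_gt1; rewrite /hdist /graph_dist; set a := fun n => _.
have walk_d : a (ndiff y z).
  have [p [path_p last_p] size_p] := ex_path_ndiff y z.
  apply/existsP; exists (tcast size_p (in_tuple p)).
  by rewrite val_tcast /= path_p last_p eqxx.
(* The distance is at most [D], which is less than the number [#|X| ^ D] of vertices, so it lies in
   the search range of [graph_dist]. *)
have lt_d : (ndiff y z < #|vertex D X|)%N.
  rewrite card_vertex; exact: leq_ltn_trans (ndiff_leq y z) (ltn_expl D r_gt1).
have has_a : has a (iota 0 #|vertex D X|).
  by apply/hasP; exists (ndiff y z); rewrite ?mem_iota.
apply/eqP; rewrite eqn_leq; apply/andP; split.
  rewrite leqNgt; apply/negP=> /(before_find 0%N).
  by rewrite nth_iota ?add0n ?walk_d.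
have := nth_find 0%N has_a; have := has_a; rewrite has_find size_iota => lt_f.
rewrite nth_iota // add0n => /existsP[p /andP[path_p /eqP last_p]].
by rewrite -{1}last_p (leq_trans (path_ndiff path_p)) ?size_tuple.
Qed.

End HammingDistance.

(** * The algebra generated by two idempotents *)

(** The relations [ese = q e] and [ses = q s] make the span of [1], [e], [s], [es], [se] an algebra,
    so matrix identities reduce to identities between five coefficients. Locking keeps the
    combinations folded during these computations. *)
HB.lock Definition idem_comb (C : fieldType) (n : nat) (e s : 'M[C]_n)
    (a b c d f : C) : 'M[C]_n :=
  a *: 1%:M + b *: e + c *: s + d *: (e *m s) + f *: (s *m e).

Section TwoIdempotents.
Variables (C : fieldType) (n : nat) (e s : 'M[C]_n) (q : C).
Hypothesis ee : e *m e = e.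
Hypothesis ss : s *m s = s.
Hypothesis ese : e *m s *m e = q *: e.
Hypothesis ses : s *m e *m s = q *: s.
Hypothesis q_neq0 : q != 0.
Hypothesis q_neq1 : 1 - q != 0.
Hypothesis two_neq0 : (2 : C) != 0.

Local Notation comb := (idem_comb e s).

Lemma combE a b c d f :
  comb a b c d f = a *: 1%:M + b *: e + c *: s + d *: (e *m s) + f *: (s *m e).
Proof. by rewrite unlock. Qed.

Lemma eq_comb a b c d f a' b' c' d' f' :
  a = a' -> b = b' -> c = c' -> d = d' -> f = f' ->
  comb a b c d f = comb a' b' c' d' f'.
Proof. by do 5!move->. Qed.

Lemma combM a b c d f a' b' c' d' f' :
  comb a b c d f *m comb a' b' c' d' f' =
  comb (a * a')
    (a * b' + b * a' + b * b' + q * (b * f' + d * b' + d * f'))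
    (a * c' + c * a' + c * c' + q * (c * d' + f * c' + f * d'))
    (a * d' + d * a' + b * c' + b * d' + d * c' + q * (d * d'))
    (a * f' + f * a' + c * b' + c * f' + f * b' + q * (f * f')).
Proof.
have e_es : e *m (e *m s) = e *m s by rewrite mulmxA ee.
have e_se : e *m (s *m e) = q *: e by rewrite mulmxA ese.
have s_es : s *m (e *m s) = q *: s by rewrite mulmxA ses.
have s_se : s *m (s *m e) = s *m e by rewrite mulmxA ss.
have es_s : e *m s *m s = e *m s by rewrite -mulmxA ss.
have se_e : s *m e *m e = s *m e by rewrite -mulmxA ee.
have es_es : e *m s *m (e *m s) = q *: (e *m s) by rewrite mulmxA ese scalemxAl.
have es_se : e *m s *m (s *m e) = q *: e by rewrite mulmxA es_s ese.
have se_es : s *m e *m (e *m s) = q *: s by rewrite mulmxA se_e ses.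
have se_se : s *m e *m (s *m e) = q *: (s *m e) by rewrite mulmxA ses scalemxAl.
rewrite !combE !mulmxDl !mulmxDr -!scalemxAl -!scalemxAr !mul1mx !mulmx1.
rewrite ee ss e_es e_se s_es s_se es_s se_e es_es es_se se_es se_se ese ses.
move: 1%:M (e *m s) (s *m e) => I es se.
by apply/matrixP=> i j; rewrite !mxE; ring.
Qed.

Lemma combD a b c d f a' b' c' d' f' :
  comb a b c d f + comb a' b' c' d' f'
    = comb (a + a') (b + b') (c + c') (d + d') (f + f').
Proof.
rewrite !combE; move: 1%:M (e *m s) (s *m e) => I es se.
by apply/matrixP=> i j; rewrite !mxE; ring.
Qed.

Lemma combZ k a b c d f :
  k *: comb a b c d f = comb (k * a) (k * b) (k * c) (k * d) (k * f).
Proof. by rewrite !combE !scalerDr !scalerA. Qed.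

Lemma combB a b c d f a' b' c' d' f' :
  comb a b c d f - comb a' b' c' d' f'
    = comb (a - a') (b - b') (c - c') (d - d') (f - f').
Proof. by rewrite -scaleN1r combZ combD !mulN1r. Qed.

Lemma comb_idl : e = comb 0 1 0 0 0.
Proof. by rewrite !combE !scale0r scale1r !addr0 add0r. Qed.

Lemma comb_idr : s = comb 0 0 1 0 0.
Proof. by rewrite !combE !scale0r scale1r !addr0 !add0r. Qed.

Lemma comb1 : 1%:M = comb 1 0 0 0 0.
Proof. by rewrite !combE !scale0r scale1r !addr0. Qed.

Let k := (1 - q)^-1.

(** The factor [k] comes from [(e + s - es - se) e = (1 - q) e] and the same equation for [s]; thus
    [csupp] is the unit of the 2 by 2 block. *)
Definition csupp := comb 0 k k (- k) (- k).
(* Inside the block with unit [csupp], [idem_p] is the projection onto the image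
   of [s] along the image of [e], and [idem_m] is the complementary one. *)
Definition idem_p := comb 0 0 k 0 (- k).
Definition idem_m := comb 0 k 0 (- k) 0.

(* The indices [Some true], [Some false], [None] carry the weights 1, -1, 0. *)
Definition comm_idem (j : option bool) : 'M[C]_n :=
  if j is Some b then if b then idem_p else idem_m else 1%:M - csupp.

Definition comm_weight (j : option bool) : int :=
  if j is Some b then if b then 1 else -1 else 0.

Lemma comm_idemM i j : comm_idem i *m comm_idem j = if i == j then comm_idem i else 0.
Proof.
have zero : 0 = comb 0 0 0 0 0 by rewrite !combE !scale0r !addr0.
case: i j => [[]|] [[]|] /=; rewrite /idem_p /idem_m /csupp /k ?comb1 ?combB combM
  ?zero; apply: eq_comb; field; rewrite ?q_neq1 //.
Qed.

Lemma big_option_bool (V : nmodType) (F : option bool -> V) :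
  \sum_j F j = F (Some true) + F (Some false) + F None.
Proof.
rewrite (bigD1 (Some true)) // (bigD1 (Some false)) // (bigD1 None) //= big1.
  by rewrite addr0 addrA.
by case=> [[]|].
Qed.

Lemma sum_comm_idem : \sum_j comm_idem j = 1%:M.
Proof.
rewrite big_option_bool /= /idem_p /idem_m /csupp /k !comb1 combB !combD.
apply: eq_comb; field; rewrite ?q_neq1 //.
Qed.

(** Since [s] and [idem_p] are idempotents with the same image, their difference squares to zero,
    and likewise for [e] and [idem_m]. The factor [q^-1] comes from
    [(s - idem_p) (e - idem_m) = q idem_p]. *)
Definition comm_h := idem_p - idem_m.
Definition comm_e := s - idem_p.
Definition comm_f := q^-1 *: (e - idem_m).

Lemma comm_hE : comm_h = \sum_j (comm_weight j)%:~R *: comm_idem j.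
Proof. by rewrite big_option_bool /= scale1r scale0r addr0 scaleN1r. Qed.

(** This is [s] minus its complement [csupp - s] in the block; [dual_e] and [dual_f] are, up to
    scalars, the corners [s e (csupp - s)] and [(csupp - s) e s] of [e]. *)
Definition dual_h := 2 *: s - csupp.
Definition dual_e := comb 0 0 (- q) 0 1.
(* The factor comes from [(se - qs) (es - qs) = q (1 - q) s]. *)
Definition dual_f := (q * (1 - q))^-1 *: comb 0 0 (- q) 1 0.

Lemma comb_idlZ c : c *: e = comb 0 c 0 0 0.
Proof. by rewrite !combE !scale0r !addr0 add0r. Qed.

Lemma comb_idrZ c : c *: s = comb 0 0 c 0 0.
Proof. by rewrite !combE !scale0r !addr0 !add0r. Qed.

Ltac comb_identity := rewrite /csupp /idem_p /idem_m /k /=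
  ?(comb1, combB, combD, combZ, combM); apply: eq_comb; field;
  rewrite ?q_neq0 ?q_neq1 ?two_neq0 //.

Lemma comm_eE : comm_e = comb 0 0 (1 - k) 0 k.
Proof. by rewrite /comm_e {1}comb_idr; comb_identity. Qed.

Lemma comm_fE : comm_f = comb 0 (q^-1 * (1 - k)) 0 (q^-1 * k) 0.
Proof. by rewrite /comm_f {1}comb_idl; comb_identity. Qed.

Lemma comm_hE2 : comm_h = comb 0 (- k) k k (- k).
Proof. by rewrite /comm_h; comb_identity. Qed.

Lemma dual_hE : dual_h = comb 0 (- k) (2 - k) k k.
Proof. by rewrite /dual_h comb_idrZ; comb_identity. Qed.

Let commE := (comm_hE2, comm_eE, comm_fE).

Lemma comm_he : comm_h *m comm_e - comm_e *m comm_h = 2 *: comm_e.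
Proof. by rewrite !commE; comb_identity. Qed.

Lemma comm_hf : comm_h *m comm_f - comm_f *m comm_h = - 2 *: comm_f.
Proof. by rewrite !commE; comb_identity. Qed.

Lemma comm_ef : comm_e *m comm_f - comm_f *m comm_e = comm_h.
Proof. by rewrite !commE; comb_identity. Qed.

Lemma dual_he : dual_h *m dual_e - dual_e *m dual_h = 2 *: dual_e.
Proof. by rewrite dual_hE /dual_e; comb_identity. Qed.

Lemma dual_hf : dual_h *m dual_f - dual_f *m dual_h = - 2 *: dual_f.
Proof. by rewrite dual_hE /dual_f; comb_identity. Qed.

Lemma dual_ef : dual_e *m dual_f - dual_f *m dual_e = dual_h.
Proof. by rewrite dual_hE /dual_e /dual_f; comb_identity. Qed.

Lemma csuppC a b c d f :
  csupp *m comb a b c d f - comb a b c d f *m csupp = 0.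
Proof.
have -> : (0 : 'M_n) = comb 0 0 0 0 0 by rewrite !combE !scale0r !addr0.
by comb_identity.
Qed.

Lemma bracket_idl_idr : e *m s - s *m e = comb 0 0 0 1 (- 1).
Proof. by rewrite !combE !scale0r !add0r scale1r scaleN1r. Qed.

(** One bracket gives [es - se], two give [es + se] up to a multiple of [e]; together they reach
    [es] and [se] separately. *)
Lemma bracket_idl2_idr :
  e *m (e *m s - s *m e) - (e *m s - s *m e) *m e = comb 0 (- 2 * q) 0 1 1.
Proof.
rewrite bracket_idl_idr.
transitivity (comb 0 1 0 0 0 *m comb 0 0 0 1 (- 1)
  - comb 0 0 0 1 (- 1) *m comb 0 1 0 0 0); first by rewrite -comb_idl.
by rewrite ?(combB, combD, combZ, combM); apply: eq_comb; ring.
Qed.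

(** With the three lemmas that follow, this recovers [e] and [s] from either triple and [csupp], so
    that stability under the triple and [csupp] can be carried back to [e] and [s]. *)
Lemma idr_comm : s = comm_e + 2^-1 *: (comm_h + csupp).
Proof. by rewrite [LHS]comb_idr !commE; comb_identity. Qed.

Lemma idl_comm : e = q *: comm_f + 2^-1 *: (csupp - comm_h).
Proof. by rewrite [LHS]comb_idl !commE; comb_identity. Qed.

Lemma idr_dual : s = 2^-1 *: (dual_h + csupp).
Proof. by rewrite [LHS]comb_idr dual_hE; comb_identity. Qed.

Lemma idl_dual : e = dual_e + (q * (1 - q)) *: dual_f
  + ((2 * q - 1) / 2) *: dual_h + 2^-1 *: csupp.
Proof. by rewrite [LHS]comb_idl dual_hE /dual_e /dual_f; comb_identity. Qed.

(** The factor of [comm_mx_D] at one coordinate when [q = 1 / r]: the last two terms are the factors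
    of [A_D] and [A_D^*], the first two are their inverses. *)
Definition comm_site :=
  (k *: e - 1%:M) *m (k *: s - 1%:M) *m (q^-1 *: e - 1%:M) *m (q^-1 *: s - 1%:M).

(** The spectral form required by [tensmx_exp_derivmx]; the base [1 - q^-1] is [1 - r] when
    [q = 1 / r]. *)
Lemma comm_siteE : comm_site = \sum_j (1 - q^-1) ^ comm_weight j *: comm_idem j.
Proof.
have q1 : q - 1 != 0 by rewrite -opprB oppr_eq0.
rewrite big_option_bool /comm_site !comb_idlZ !comb_idrZ.
rewrite /= expr1z expr0z exprN1 (_ : (1 - q^-1)^-1 = - q * k).
  by comb_identity.
by rewrite /k; field; rewrite q_neq0 q_neq1 q1.
Qed.

Lemma idlK : (q^-1 *: e - 1%:M) *m (k *: e - 1%:M) = 1%:M.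
Proof. by rewrite !comb_idlZ; comb_identity. Qed.

Lemma idrK : (q^-1 *: s - 1%:M) *m (k *: s - 1%:M) = 1%:M.
Proof. by rewrite !comb_idrZ; comb_identity. Qed.

End TwoIdempotents.

(** * Modules of the subconstituent algebra *)

(** The rows of [M] lie in [U], and those of [1%:M - M] are orthogonal to [U] because [M] is real,
    symmetric and idempotent. *)
Lemma cproj_ortho_idem (C : numClosedFieldType) n (M U : 'M[C]_n) :
    M *m M = M -> M^T = M -> map_mx Num.conj M = M -> (M :=: U)%MS ->
  cproj_ortho U = M.
Proof.
move=> MM trM conjM eqMU; rewrite -[RHS]trM; congr trmx.
rewrite -[LHS]mul1mx -[1%:M](subrK M) mulmxDl.
rewrite [M *m _]proj_ortho_id ?eqMU // proj_ortho_0 ?add0r //.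
apply/orthomx1P; have /submxP[Y ->] : (U <= M)%MS by rewrite eqMU.
by rewrite trmx_mul map_mxM /= trM conjM mulmxA mulmxBl mul1mx MM subrr mul0mx.
Qed.

Section HammingAlgebra.
Variables (C : numClosedFieldType) (D : nat) (X : finType) (x : X).
Hypothesis r_ge3 : (3 <= #|X|)%N.
Local Notation N := #|vertex D X|.
Local Notation r := (#|X|%:R : C).
Local Notation q := (r^-1).

Let r_gt1 : (1 < #|X|)%N. Proof. exact: leq_trans r_ge3. Qed.

Let r_neq0 : r != 0. Proof. by rewrite pnatr_eq0 -lt0n ltnW. Qed.

Definition site_e : 'M[C]_#|X| := const_mx q.
Definition site_s : 'M[C]_#|X| := delta_mx (enum_rank x) (enum_rank x).
Local Notation e := site_e.
Local Notation s := site_s.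

Lemma site_ee : e *m e = e.
Proof.
apply/matrixP=> i j; rewrite !mxE; under eq_bigr do rewrite !mxE.
by rewrite sumr_const card_ord -mulrnAr -[X in _ * X]mulr_natr mulVf ?mulr1.
Qed.

Lemma site_ss : s *m s = s.
Proof. by rewrite mul_delta_mx. Qed.

Lemma site_sE i j : s i j = ((i == j) && (i == enum_rank x))%:R.
Proof.
rewrite mxE; congr (_%:R); congr nat_of_bool.
by apply/andP/andP => -[/eqP-> /eqP->].
Qed.

Lemma site_ese : e *m s *m e = q *: e.
Proof.
apply/matrixP=> i j; rewrite !mxE (bigD1 (enum_rank x)) //= big1 => [|k nek].
  rewrite !mxE (bigD1 (enum_rank x)) //= big1 => [|k nek].
    by rewrite !mxE !eqxx mulr1 !addr0.
  by rewrite !mxE (negPf nek) mulr0.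
rewrite !mxE big1 ?mul0r // => l _.
by rewrite !mxE (negPf nek) andbF mulr0.
Qed.

Lemma site_ses : s *m e *m s = q *: s.
Proof.
apply/matrixP=> i j; rewrite !mxE (bigD1 (enum_rank x)) //= big1 => [|k nek].
  rewrite !mxE (bigD1 (enum_rank x)) //= big1 => [|k nek].
    by rewrite !mxE !eqxx /= andbT !addr0 mulrAC mulrC -natrM mulnb.
  by rewrite !mxE (negPf nek) andbF mul0r.
by rewrite [s k j]mxE (negPf nek) mulr0.
Qed.

Definition Pmx : 'M[C]_N := derivmx D e.
Definition Qmx : 'M[C]_N := derivmx D s.

(** The eigenprojection of [Pmx] for the eigenvalue [j], the number of coordinates that carry
    [e]. *)
Definition eig_idem (j : nat) : 'M[C]_N := esymmx D j e (1%:M - e).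

Lemma Pmx_eig j : Pmx *m eig_idem j = j%:R *: eig_idem j.
Proof. by apply: derivmx_esymmx; rewrite ?mulmxBr ?mulmx1 site_ee ?subrr. Qed.

Lemma site_e_tr : e^T = e. Proof. exact: trmx_const. Qed.

Lemma eig_idem_tr j : (eig_idem j)^T = eig_idem j.
Proof. by rewrite esymmx_tr linearB /= trmx1 site_e_tr. Qed.

Lemma sum_eig_idem : \sum_(j < D.+1) eig_idem j = 1%:M.
Proof. by rewrite sum_esymmx -tensmx1; apply: eq_tensmx => k; rewrite addrC subrK. Qed.

(** Orthogonality comes from symmetry and the distinct eigenvalues of [Pmx]; idempotence then
    follows on multiplying the decomposition of [1%:M] by [eig_idem i]. *)
Lemma eig_idemM i j : eig_idem i *m eig_idem j = if i == j then eig_idem i else 0.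
Proof.
have ne0 k l : k != l -> eig_idem k *m eig_idem l = 0.
  move=> nekl; have Pr : eig_idem k *m Pmx = k%:R *: eig_idem k.
    apply: trmx_inj; rewrite trmx_mul linearZ /= derivmx_tr site_e_tr.
    by rewrite !eig_idem_tr Pmx_eig.
  apply/eqP.
  have /eqP : eig_idem k *m Pmx *m eig_idem l = k%:R *: (eig_idem k *m eig_idem l).
    by rewrite Pr scalemxAl.
  rewrite -mulmxA Pmx_eig -scalemxAr -subr_eq0 -scalerBl scaler_eq0 subr_eq0 eqr_nat.
  by rewrite eq_sym (negPf nekl).
case: eqP => [<-|/eqP/ne0//]; have [leiD|ltDi] := leqP i D.
  rewrite -[RHS]mulmx1 -sum_eig_idem [RHS]mulmx_sumr.
  rewrite [RHS](bigD1 (Ordinal (leiD : (i < D.+1)%N))) //=.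
  rewrite [X in _ + X]big1 ?addr0 // => l nel.
  by apply: ne0; rewrite eq_sym; apply: contra_neq nel => eqli; apply: val_inj.
(* For [i > D] no set of coordinates has [i] elements. *)
suff -> : eig_idem i = 0 by rewrite mulmx0.
rewrite /eig_idem /esymmx big_pred0 // => S.
by apply/negbTE; rewrite neq_ltn (leq_ltn_trans (card_coords S)).
Qed.

(** [r *: e - 1%:M] has entries 0 on the diagonal and 1 off it, so the generating polynomial of an
    entry is ['X] to the number of differing coordinates. *)
Lemma dist_mxE i : dist_mx C D X i = esymmx D i (r *: e - 1%:M) 1%:M.
Proof.
apply/matrixP=> j k; rewrite esymmxE mxE hdistE //.
set y := enum_val j; set z := enum_val k.
rewrite (eq_bigr (fun l => if l \in [set l | y l != z l] then 'X else 1)).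
  by rewrite prod_card_if expr1n mulr1 coefXn eq_sym.
move=> l _; rewrite !mxE mulfV // inE /site (inj_eq enum_rank_inj) -/y -/z.
by case: eqP => _; rewrite ?subrr ?subr0 ?scale0r ?scale1r ?add0r ?addr0.
Qed.

(** For [j <= D], the Krawtchouk polynomial of degree [i] at [D - j], through its generating
    function. *)
Definition krawt i j : C := (((r - 1) *: 'X + 1) ^+ j * ((-1) *: 'X + 1) ^+ (D - j))`_i.

Lemma dist_mx_eig i j : dist_mx C D X i *m eig_idem j = krawt i j *: eig_idem j.
Proof.
rewrite dist_mxE; apply: esymmx_mul.
  by rewrite mulmxBl -scalemxAl site_ee mul1mx -[X in _ - X]scale1r -scalerBl.
rewrite mulmxBl -scalemxAl mulmxBr mulmx1 site_ee subrr scaler0 sub0r mul1mx.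
by rewrite scaleN1r.
Qed.

Lemma dist_mx_sum i : dist_mx C D X i = \sum_(j < D.+1) krawt i j *: eig_idem j.
Proof.
rewrite -[LHS]mulmx1 -sum_eig_idem [LHS]mulmx_sumr.
by apply: eq_bigr => j _; rewrite dist_mx_eig.
Qed.

Lemma dist_mx1 : dist_mx C D X 1 = r *: Pmx - D%:R%:M.
Proof. by rewrite dist_mxE esymmx1 derivmxB derivmxZ derivmx1. Qed.

Lemma dist_mxD : dist_mx C D X D = tensmx (fun=> r *: e - 1%:M).
Proof. by rewrite dist_mxE esymmx_full. Qed.

Lemma dist_mx1_eig j : dist_mx C D X 1 *m eig_idem j = (r * j%:R - D%:R) *: eig_idem j.
Proof. by rewrite dist_mx1 mulmxBl -scalemxAl Pmx_eig mul_scalar_mx scalerA scalerBl. Qed.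

Lemma eig_idem_conj j : map_mx Num.conj (eig_idem j) = eig_idem j.
Proof.
rewrite /eig_idem /esymmx map_mx_sum; apply: eq_bigr => S _.
apply/matrixP=> k l; rewrite !mxE /= rmorph_prod; apply: eq_bigr => m _ /=.
have conj_q : (q)^* = q by rewrite fmorphV /= conjC_nat.
by case: ifP => _; rewrite !mxE ?rmorphB /= ?conj_q ?conjC_nat.
Qed.

(** The index is reversed because [eig_idem j] belongs to the eigenvalue [r j - D] of [A_1], and
    [(r - 1) D - r i = r (D - i) - D]. *)
Lemma prim_idemE i : (i <= D)%N -> prim_idem C D X i = eig_idem (D - i)%N.
Proof.
move=> leiD; apply: cproj_ortho_idem;
  rewrite ?eig_idemM ?eqxx ?eig_idem_tr ?eig_idem_conj //.
have trA : (dist_mx C D X 1)^T = dist_mx C D X 1.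
  by rewrite dist_mx1 linearB /= linearZ /= tr_scalar_mx derivmx_tr site_e_tr.
have eig_l j : eig_idem j *m dist_mx C D X 1 = (r * j%:R - D%:R) *: eig_idem j.
  by apply: trmx_inj; rewrite trmx_mul linearZ /= trA eig_idem_tr dist_mx1_eig.
have th : hamming_eig C D X i = r * (D - i)%N%:R - D%:R.
  by rewrite /hamming_eig natrB //; ring.
rewrite /ceigenspace trA; apply/eqmxP/andP; split.
  by apply/eigenspaceP; rewrite eig_l th.
set U := eigenspace _ _.
have /eigenspaceP UA : (U <= U)%MS by [].
suff -> : U = U *m eig_idem (D - i)%N by rewrite submxMl.
rewrite -[LHS]mulmx1 -sum_eig_idem [LHS]mulmx_sumr.
have ltj : (D - i < D.+1)%N by rewrite ltnS leq_subr.
rewrite (bigD1 (Ordinal ltj)) //= big1 ?addr0 // => j nej; apply/eqP.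
have /eqP := congr1 (fun M => M *m eig_idem j) UA.
rewrite -mulmxA dist_mx1_eig -scalemxAr -scalemxAl -subr_eq0 -scalerBl scaler_eq0.
case/orP=> //; rewrite th opprB addrA subrK -mulrBr mulf_eq0 (negPf r_neq0) /=.
rewrite subr_eq0 eqr_nat => /eqP eqj; case/eqP: nej; exact: val_inj.
Qed.

(** * Diagonal matrices that depend only on the distance to the base vertex *)

Local Notation x0 := (base_vertex D x).

Definition radial (F : nat -> C) : 'M[C]_N :=
  diag_mx (\row_j F (hdist x0 (enum_val j))).

Lemma radial_idem F (i : nat) : radial F *m dual_idem C D x i = F i *: dual_idem C D x i.
Proof.
apply/matrixP=> j k; rewrite mul_diag_mx !mxE.
by case: (hdist _ _ =P i) => [->|_]; rewrite ?mul0rn ?mulr0.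
Qed.

Lemma hdist_leD y z : (@hdist D X y z < D.+1)%N.
Proof. by rewrite hdistE // ltnS ndiff_leq. Qed.

Lemma radial_sum F : radial F = \sum_(i < D.+1) F i *: dual_idem C D x i.
Proof.
apply/matrixP=> j k; rewrite summxE !mxE.
rewrite (bigD1 (Ordinal (hdist_leD x0 (enum_val j)))) //= big1 ?addr0.
  by rewrite !mxE eqxx mulr_natr.
move=> i nei; rewrite !mxE.
suff /negPf-> : hdist x0 (enum_val j) != i by rewrite mul0rn mulr0.
by apply: contra_neq nei => eqi; apply: val_inj.
Qed.

Lemma sum_dual_idem : \sum_(i < D.+1) dual_idem C D x i = 1%:M.
Proof.
rewrite (eq_bigr (fun i : 'I_D.+1 => 1 *: dual_idem C D x i)).
  by rewrite -(radial_sum (fun=> 1)); apply/matrixP=> j k; rewrite !mxE.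
by move=> i _; rewrite scale1r.
Qed.

Lemma site_base k : site (enum_rank x0) k = enum_rank x.
Proof. by rewrite /site enum_rankK ffunE. Qed.

Lemma prod_base (R : comNzRingType) (y z : R) (j : 'I_N) :
  \prod_k (if site j k == enum_rank x then y else z)
    = y ^+ (D - hdist x0 (enum_val j)) * z ^+ hdist x0 (enum_val j).
Proof.
rewrite (eq_bigr (fun k => if k \in [set k | x0 k != enum_val j k] then z else y)).
  by rewrite prod_card_if mulrC hdistE.
move=> k _; rewrite inE ffunE (inj_eq enum_rank_inj) eq_sym.
by case: eqP.
Qed.

Lemma dual_dist_mx_radial i : (i <= D)%N -> exists F, dual_dist_mx C D x i = radial F.
Proof.
(* In the row of the base vertex, a coordinate equal to [x] contributes the diagonal entries [q] and
   [1 - q] of [e] and [1%:M - e], any other coordinate the entries [q] and [- q]. *)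
move=> leiD; exists (fun n => r ^+ D *
  ((q *: 'X + (1 - q)%:P) ^+ (D - n) * (q *: 'X + (- q)%:P) ^+ n)`_(D - i)).
rewrite /dual_dist_mx prim_idemE //.
congr diag_mx; apply/rowP=> j; rewrite [LHS]mxE [RHS]mxE esymmxE -prod_base.
congr (_ * nth 0 (polyseq _) _); apply: eq_bigr => k _.
rewrite !mxE site_base eq_sym.
by case: eqP; rewrite ?sub0r.
Qed.

Lemma site_dualE a b :
  (r *: s - 1%:M) a b = (a == b)%:R * (if a == enum_rank x then r - 1 else -1).
Proof.
have -> : (r *: s - 1%:M) a b = r * s a b - (a == b)%:R by rewrite !mxE.
rewrite site_sE; case: eqP => _ /=; last by rewrite mulr0 mul0r subrr.
by case: eqP => _; rewrite ?mulr1 ?mulr0 ?sub0r ?mul1r.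
Qed.

Lemma dual_dist_mxD : dual_dist_mx C D x D = tensmx (fun=> r *: s - 1%:M).
Proof.
rewrite /dual_dist_mx prim_idemE // subnn /eig_idem esymmx0.
apply/matrixP=> i j; rewrite [LHS]mxE [RHS]mxE [X in X *+ _]mxE [tensmx _ _ _]mxE.
rewrite [RHS](eq_bigr (fun k => (site i k == site j k)%:R
  * (if site i k == enum_rank x then r - 1 else -1))); last first.
  by move=> k _; exact: site_dualE.
rewrite big_split /= prod_site_eq -[LHS]mulr_natl; congr (_ * _).
(* Each coordinate absorbs one factor of [r ^+ D]. *)
rewrite -[X in r ^+ X](card_ord D) -prodr_const -big_split /=.
apply: eq_bigr => k _; rewrite !mxE site_base eq_sym.
by case: eqP => _; rewrite mulrBr mulfV // ?mulr1 ?mulr0 ?sub0r.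
Qed.

Definition dual_eigD n : C := (r - 1) ^+ (D - n) * (-1) ^+ n.

Lemma dual_dist_mxD_radial : dual_dist_mx C D x D = radial dual_eigD.
Proof.
rewrite dual_dist_mxD; apply/matrixP=> i j; rewrite mxE [RHS]mxE [X in _ = X *+ _]mxE.
rewrite /dual_eigD -prod_base.
rewrite -[RHS]mulr_natl -prod_site_eq -big_split; apply: eq_bigr => k _.
exact: site_dualE.
Qed.

(** The absolute values [(r - 1) ^ (D - n)] are distinct because [r - 1 > 1]. *)
Lemma dual_eigD_inj : injective (fun i : 'I_D.+1 => dual_eigD i).
Proof.
move=> i j /(congr1 Num.norm); rewrite /dual_eigD !normrM !normrX normrN1 !expr1n !mulr1.
rewrite -(natrB _ (ltnW r_gt1)) !normr_nat -!natrX => /eqP.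
rewrite eqr_nat eqn_exp2l ?ltn_subRL ?addn1 // => /eqP eqD; apply: val_inj => /=.
by rewrite -[LHS](subKn (_ : i <= D)%N) ?eqD ?subKn // -ltnS.
Qed.

Lemma Qmx_radial : Qmx = radial (fun n => (D - n)%:R).
Proof.
apply/matrixP=> i j; rewrite summxE !mxE.
rewrite (eq_bigr (fun k => (site i k == enum_rank x)%:R *+ (i == j))); last first.
  move=> k _; rewrite mxE (eq_bigr (fun l => (site i l == site j l)%:R
    * (if l == k then (site i k == enum_rank x)%:R else 1))).
    by rewrite big_split /= prod_site_eq -big_mkcond big_pred1_eq mulr_natl.
  move=> l _; case: eqP => [->|_]; rewrite ?mulr1 ?site_sE ?mxE //.
  by rewrite -natrM mulnb.
rewrite sumrMnl -natr_sum; congr (_%:R *+ _).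
rewrite -big_mkcond sum1_card -cardsE cardsCs card_ord hdistE //; congr (_ - _)%N.
apply: eq_card => k; rewrite !inE ffunE -(inj_eq enum_rank_inj) eq_sym.
by [].
Qed.

Hypothesis D_gt0 : (0 < D)%N.

(** [Pmx] is affine in [A_1], and [A_D^*] alone separates the distances, so interpolation yields the
    dual idempotents and [Qmx]. Conversely the distinct eigenvalues of [Pmx] and [Qmx] give back all
    generators. *)
Lemma module_stable (U : {vspace 'cV[C]_N}) :
  is_module (subconstituent_alg C D x) U <-> stable Pmx U /\ stable Qmx U.
Proof.
split=> [modU | [sP sQ] B TB].
  have gen_stable B i : (i <= D)%N ->
      B = dist_mx C D X i \/ B = dual_dist_mx C D x i -> stable B U.
    by move=> leiD defB; apply/stableP/modU/gen_alg_in; exists i.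
  split.
    have -> : Pmx = q *: (dist_mx C D X 1 + D%:R *: 1%:M).
      by rewrite dist_mx1 scalemx1 subrK scalerA mulVf ?scale1r.
    apply/stableZ/stableD; last exact/stableZ/stable1.
    by apply: (gen_stable _ 1%N) => //; left.
  rewrite Qmx_radial radial_sum; apply: stable_sum => i _; apply: stableZ.
  apply: (@stable_spectral_idem C _ _ (dual_dist_mx C D x D)
    (fun i : 'I_D.+1 => dual_idem C D x i) _ U i dual_eigD_inj sum_dual_idem).
    by move=> j; rewrite dual_dist_mxD_radial radial_idem.
  by apply: (gen_stable _ D) => //; right.
have natr_inj : injective (fun i : 'I_D.+1 => i%:R : C).
  by move=> i j /eqP; rewrite eqr_nat => /eqP/val_inj.
have natrB_inj : injective (fun i : 'I_D.+1 => (D - i)%:R : C).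
  move=> i j /eqP; rewrite eqr_nat => /eqP eqD; apply: val_inj => /=.
  by rewrite -[LHS](subKn (_ : i <= D)%N) ?eqD ?subKn // -ltnS.
apply/stableP.
elim: {B}TB => [B [i leiD [->|->]] | | c A _ sA | A B _ sA _ sB | A B _ sA _ sB].
- rewrite dist_mx_sum; apply: stable_sum => j _; apply: stableZ.
  by apply: (@stable_spectral_idem C _ _ Pmx (fun i : 'I_D.+1 => eig_idem i) _ U j
    natr_inj sum_eig_idem _ sP) => k; rewrite Pmx_eig.
- have [F ->] := dual_dist_mx_radial leiD.
  rewrite radial_sum; apply: stable_sum => j _; apply: stableZ.
  apply: (@stable_spectral_idem C _ _ Qmx (fun i : 'I_D.+1 => dual_idem C D x i) _ U j
    natrB_inj sum_dual_idem _ sQ) => k.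
  by rewrite Qmx_radial radial_idem.
- exact: stable1.
- exact: stableZ.
- exact: stableD.
- exact: stableM.
Qed.

End HammingAlgebra.

(** * Irreducible modules *)

Section IrreducibleModule.
Variables (C : numClosedFieldType) (D : nat) (X : finType) (x : X).
Hypothesis r_ge3 : (3 <= #|X|)%N.
Hypothesis D_gt0 : (0 < D)%N.
Local Notation N := #|vertex D X|.
Local Notation r := (#|X|%:R : C).
Local Notation q := (r^-1).
Local Notation e := (site_e C X).
Local Notation s := (site_s C x).
Local Notation P := (Pmx C D X).
Local Notation Q := (Qmx C D x).
Local Notation comb := (idem_comb e s).

Let ee := site_ee C r_ge3.
Let ss : s *m s = s := site_ss C x.
Let ese : e *m s *m e = q *: e := site_ese C x.
Let ses : s *m e *m s = q *: s := site_ses C x.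

Let r_neq0 : r != 0.
Proof. by rewrite pnatr_eq0 -lt0n (leq_trans _ r_ge3). Qed.

Let q_neq0 : q != 0. Proof. by rewrite invr_eq0. Qed.

Let q_neq1 : 1 - q != 0.
Proof.
rewrite subr_eq0 eq_sym invr_eq1 pnatr_eq1 neq_ltn orbC.
by rewrite (leq_trans _ r_ge3).
Qed.

Let two_neq0 : (2 : C) != 0. Proof. by rewrite pnatr_eq0. Qed.

Definition Kmx : 'M[C]_N := derivmx D (csupp e s q).

Section CombStable.
Variable U : {vspace 'cV[C]_N}.
Hypotheses (sP : stable P U) (sQ : stable Q U).

(** The brackets [[P, Q]] and [[P, [P, Q]]] provide the difference and, modulo [P], the sum of the
    actions of [es] and [se]. *)
Lemma stable_derivmx_comb b c d f : stable (derivmx D (comb 0 b c d f)) U.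
Proof.
have s1 : stable (derivmx D (e *m s) - derivmx D (s *m e)) U.
  by rewrite -derivmxB -derivmx_bracket; apply: stableB; apply: stableM.
have s2 : stable (derivmx D (e *m s) + derivmx D (s *m e)) U.
  have -> : derivmx D (e *m s) + derivmx D (s *m e)
      = derivmx D (comb 0 (- 2 * q) 0 1 1) + (2 * q) *: P.
    rewrite combE !scale0r !scale1r addr0 add0r !derivmxD derivmxZ.
    by rewrite -!addrA addrC -!addrA mulNr scaleNr subrr addr0.
  apply: stableD; last exact: stableZ.
  rewrite -bracket_idl2_idr // -derivmx_bracket [X in stable (_ *m X - X *m _)]derivmxB.
  by apply: stableB; apply: stableM.
have ses2 : stable (2 *: derivmx D (e *m s)) U.
  have -> : 2 *: derivmx D (e *m s) = (derivmx D (e *m s) + derivmx D (s *m e))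
      + (derivmx D (e *m s) - derivmx D (s *m e)).
    by rewrite addrACA subrr addr0 scaler_nat mulr2n.
  exact: stableD.
have s_es : stable (derivmx D (e *m s)) U.
  by rewrite -[derivmx _ _]scale1r -(mulVf two_neq0) -scalerA; apply: stableZ.
have s_se : stable (derivmx D (s *m e)) U.
  rewrite -[derivmx _ _](addKr (derivmx D (e *m s))) addrC; exact: stableB.
rewrite combE scale0r add0r !derivmxD !derivmxZ.
by do 3?apply: stableD; exact: stableZ.
Qed.

End CombStable.

Lemma Kmx_comb b c d f (v : 'cV[C]_N) (kap : C) : Kmx *m v = kap *: v ->
  Kmx *m (derivmx D (comb 0 b c d f) *m v) = kap *: (derivmx D (comb 0 b c d f) *m v).
Proof.
move=> Kv; have := derivmx_bracket D (csupp e s q) (comb 0 b c d f).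
rewrite csuppC // derivmx0 => /eqP.
by rewrite subr_eq0 mulmxA => /eqP->; rewrite -mulmxA Kv scalemxAr.
Qed.

Lemma Pmx_comb : P = derivmx D (comb 0 1 0 0 0).
Proof. by rewrite -comb_idl. Qed.

Lemma Qmx_comb : Q = derivmx D (comb 0 0 1 0 0).
Proof. by rewrite -comb_idr. Qed.

Variable W : {vspace 'cV[C]_N}.
Hypothesis irrW : irreducible_module (subconstituent_alg C D x) W.

Let W_neq0 : W <> 0%VS. Proof. by case: irrW. Qed.

Let sPQ : stable P W /\ stable Q W.
Proof. by apply/module_stable => //; case: irrW. Qed.

Let s_comb b c d f : stable (derivmx D (comb 0 b c d f)) W.
Proof. by case: sPQ => sP sQ; apply: stable_derivmx_comb. Qed.

Let W_min U : (U <= W)%VS -> U <> 0%VS -> stable P U -> stable Q U -> U = W.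
Proof.
move=> sUW U0 sP sQ; case: irrW => _ _ minW.
by case: (minW U) => //; apply/module_stable.
Qed.

(** Schur's lemma: [Kmx] commutes with [P] and [Q], so an eigenspace of it in [W] is a nonzero
    submodule. *)
Lemma Kmx_scalar : exists kap : C, forall w, w \in W -> Kmx *m w = kap *: w.
Proof.
have [kap [v Wv [v0 Kv]]] := stable_eigenvector W_neq0 (s_comb _ _ _ _ : stable Kmx W).
pose U := (W :&: lker (linfun (mulmx (Kmx - kap *: 1%:M))))%VS.
have memU w : (w \in U) = (w \in W) && (Kmx *m w == kap *: w).
  by rewrite memv_cap memv_ker lfunE /= mulmxBl -scalemxAl mul1mx subr_eq0.
have sU b c d f : stable (derivmx D (comb 0 b c d f)) U.
  move=> w; rewrite !memU => /andP[Ww /eqP Kw].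
  by rewrite s_comb // (Kmx_comb _ _ _ _ Kw) eqxx.
have UW : U = W.
  apply: W_min; rewrite ?capvSl ?Pmx_comb ?Qmx_comb //.
  by move=> U0; have := memU v; rewrite U0 memv0 Wv Kv eqxx (negPf v0).
by exists kap => w; rewrite -UW memU => /andP[_ /eqP].
Qed.

(** As [Kmx] is a scalar on [W], a subspace of [W] stable under the triple is a submodule; hence [W]
    is irreducible under the triple as well. *)
Lemma triple_basis h a b :
    h *m a - a *m h = 2 *: a -> h *m b - b *m h = - 2 *: b -> a *m b - b *m a = h ->
    (forall U : {vspace 'cV[C]_N}, stable P U -> stable Q U ->
       [/\ stable (derivmx D h) U, stable (derivmx D a) U & stable (derivmx D b) U]) ->
    (forall U : {vspace 'cV[C]_N}, stable (derivmx D h) U ->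
       stable (derivmx D a) U -> stable (derivmx D b) U -> stable Kmx U ->
       stable P U /\ stable Q U) ->
  exists2 v : (\dim W).-tuple 'cV[C]_N, basis_of W v &
    forall j : 'I_(\dim W), derivmx D h *m v`_j = ((\dim W).-1%:R - 2 * j%:R) *: v`_j.
Proof.
move=> ha hb ab sPQ_hab shab_PQ; have [kap KW] := Kmx_scalar.
have [||||||||m [v Wv hv]] := @sl2_irreducible_basis _ _
    (derivmx D h) (derivmx D a) (derivmx D b) W.
- by rewrite derivmx_bracket ha derivmxZ.
- by rewrite derivmx_bracket hb derivmxZ.
- by rewrite derivmx_bracket ab.
- by [].
- by case: sPQ => sP sQ; case: (sPQ_hab W).
- by case: sPQ => sP sQ; case: (sPQ_hab W).
- by case: sPQ => sP sQ; case: (sPQ_hab W).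
- move=> U sUW U0 sh sa sb.
  have [] := shab_PQ U sh sa sb; last by move=> sP sQ; apply: W_min.
  by move=> u Uu; rewrite KW ?memvZ // (subvP sUW).
have dimW : \dim W = m.+1 by rewrite -(size_basis Wv).
by rewrite dimW; exists v.
Qed.

Lemma comm_basis : exists2 v : (\dim W).-tuple 'cV[C]_N, basis_of W v &
  forall j : 'I_(\dim W), derivmx D (comm_h e s q) *m v`_j
    = ((\dim W).-1%:R - 2 * j%:R) *: v`_j.
Proof.
apply: (triple_basis (a := comm_e e s q) (b := comm_f e s q)).
- exact: comm_he.
- exact: comm_hf.
- exact: comm_ef.
- move=> U sP sQ; rewrite comm_hE2 // comm_eE // comm_fE //.
  by split; apply: stable_derivmx_comb.
move=> U sh sa sb sK; rewrite /Pmx /Qmx; split.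
  rewrite {1}(idl_comm e s q_neq0 q_neq1 two_neq0) derivmxD (derivmxZ D q).
  rewrite (derivmxZ D 2^-1) (derivmxB D (csupp e s q)).
  by apply: stableD; apply: stableZ => //; apply: stableB.
rewrite {1}(idr_comm e s q_neq1 two_neq0) derivmxD (derivmxZ D 2^-1).
rewrite (derivmxD D (comm_h e s q)).
by apply: stableD => //; apply: stableZ; apply: stableD.
Qed.

Lemma dual_basis : exists2 v : (\dim W).-tuple 'cV[C]_N, basis_of W v &
  forall j : 'I_(\dim W), derivmx D (dual_h e s q) *m v`_j
    = ((\dim W).-1%:R - 2 * j%:R) *: v`_j.
Proof.
apply: (triple_basis (a := dual_e e s q) (b := dual_f e s q)).
- exact: dual_he.
- exact: dual_hf.
- exact: dual_ef.
- move=> U sP sQ; rewrite dual_hE // /dual_f derivmxZ.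
  by split; [| | apply: stableZ]; apply: stable_derivmx_comb.
move=> U sh sa sb sK; rewrite /Pmx /Qmx; split.
  rewrite {1}(idl_dual e s q_neq0 q_neq1 two_neq0) !derivmxD (derivmxZ D (q * _)).
  rewrite (derivmxZ D (_ / 2)) (derivmxZ D 2^-1).
  by do 3?apply: stableD => //; apply: stableZ.
rewrite {1}(idr_dual e s q_neq1 two_neq0) (derivmxZ D 2^-1).
rewrite (derivmxD D (dual_h e s q)).
by apply: stableZ; apply: stableD.
Qed.

Lemma dual_idem_Qmx (i : nat) :
  dual_idem C D x i *m Q = (D - i)%N%:R *: dual_idem C D x i.
Proof.
by rewrite Qmx_radial // [LHS]diag_mxC (radial_idem D x (fun n => (D - n)%N%:R)).
Qed.

(** Basis vectors for [dual_h] are eigenvectors of [Q] with distinct eigenvalues, hence each lies in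
    the range of its own dual idempotent. *)
Lemma module_diamE : module_diam x W = (\dim W).-1.
Proof.
have [v Wv hv] := dual_basis; have [kap KW] := Kmx_scalar.
have Wvj (j : 'I_(\dim W)) : v`_j \in W.
  by apply: (basis_mem Wv); rewrite mem_nth ?size_tuple.
have vn0 (j : 'I_(\dim W)) : v`_j != 0.
  by apply: (free_not0 (basis_free Wv)); rewrite mem_nth ?size_tuple.
(* These are the eigenvalues of [Q], since [s = 2^-1 *: (dual_h + csupp)]. *)
pose lam (j : 'I_(\dim W)) : C := 2^-1 * ((\dim W).-1%:R - 2 * j%:R + kap).
have Qv (j : 'I_(\dim W)) : Q *m v`_j = lam j *: v`_j.
  rewrite /Qmx (idr_dual e s q_neq1 two_neq0) (derivmxZ D 2^-1).
  rewrite (derivmxD D (dual_h e s q)) -scalemxAl mulmxDl hv [X in _ + X]KW //.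
  by rewrite -scalerDl scalerA.
have lam_inj : injective lam.
  move=> i j /(mulfI (invr_neq0 two_neq0))/addIr/addrI/oppr_inj/(mulfI two_neq0)/eqP.
  by rewrite eqr_nat => /eqP/val_inj.
have Ev (i : 'I_D.+1) (j : 'I_(\dim W)) :
    dual_idem C D x i *m v`_j != 0 -> lam j = (D - i)%N%:R.
  move=> Ev0; have /eqP := congr1 (mulmx (dual_idem C D x i)) (Qv j).
  rewrite mulmxA dual_idem_Qmx -scalemxAl -scalemxAr -subr_eq0 -scalerBl scaler_eq0.
  by rewrite (negPf Ev0) orbF subr_eq0 => /eqP.
have sumE (j : 'I_(\dim W)) : v`_j = \sum_(i < D.+1) dual_idem C D x i *m v`_j.
  by rewrite -mulmx_suml sum_dual_idem // mul1mx.
have exE (j : 'I_(\dim W)) : exists i : 'I_D.+1, dual_idem C D x i *m v`_j != 0.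
  apply/existsP; apply: contraNT (vn0 j) => /existsPn E0.
  by rewrite sumE big1 // => i _; apply/eqP; move: (E0 i); rewrite negbK.
(* The index [f j] is the only possible one, since the eigenvalue [D - i] of [Q] determines [i]. *)
pose f j := xchoose (exE j).
have fE j : dual_idem C D x (f j) *m v`_j != 0 := xchooseP (exE j).
have natD_inj : injective (fun i : 'I_D.+1 => (D - i)%N%:R : C).
  move=> i j /eqP; rewrite eqr_nat => /eqP eqD; apply: val_inj => /=.
  by have := ltn_ord i; have := ltn_ord j; lia.
have f_inj : injective f.
  by move=> i j eqf; apply: lam_inj; rewrite (Ev _ _ (fE i)) (Ev _ _ (fE j)) eqf.
rewrite /module_diam subn1; congr _.-1.
transitivity #|f @: 'I_(\dim W)|; last by rewrite card_imset // card_ord.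
apply: eq_card => i; rewrite inE; apply/idP/imsetP => [|[j _ ->]]; last first.
  by apply: contraNneq (fE j) => E0; rewrite -memv0 -E0 mem_mximg.
rewrite -vpick0; have /mximgP[w Ww ->] := memv_pick (mximg (dual_idem C D x i) W).
rewrite (coord_basis Wv Ww) mulmx_sumr => Ew0.
have [j Evj] : exists j : 'I_(\dim W), dual_idem C D x i *m v`_j != 0.
  apply/existsP; apply: contraNT Ew0 => /existsPn E0; rewrite big1 // => j _.
  by move: (E0 j); rewrite negbK -scalemxAr => /eqP->; rewrite scaler0.
by exists j => //; apply: natD_inj; rewrite /= -(Ev _ _ Evj) (Ev _ _ (fE j)).
Qed.

(** * The commutator of [A_D] and [A_D^*] on an irreducible module *)

Local Notation mu := (1 - r).

Lemma mulmx1_invmx n (A B : 'M[C]_n) : A *m B = 1%:M -> invmx A = B.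
Proof.
by move=> AB; rewrite -[LHS]mulmx1 -AB mulKmx //; case: (mulmx1_unit AB).
Qed.

Lemma comm_mx_DE : comm_mx_D C D x = tensmx (fun=> comm_site e s q).
Proof.
rewrite /comm_mx_D (mulmx1_invmx (B := tensmx (fun=> (1 - q)^-1 *: e - 1%:M))).
  rewrite (mulmx1_invmx (B := tensmx (fun=> (1 - q)^-1 *: s - 1%:M))).
    by rewrite dist_mxD // dual_dist_mxD // !tensmxM /comm_site invrK.
  rewrite dual_dist_mxD // tensmxM -tensmx1; apply: eq_tensmx => k.
  by have := idrK ee ss ese ses q_neq0 q_neq1; rewrite invrK.
rewrite dist_mxD // tensmxM -tensmx1; apply: eq_tensmx => k.
by have := idlK ee ss ese ses q_neq0 q_neq1; rewrite invrK.
Qed.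

Lemma mu_neq0 : mu != 0.
Proof. by rewrite subr_eq0 eq_sym pnatr_eq1 neq_ltn (leq_trans _ r_ge3) ?orbT. Qed.

(** The absolute value [r - 1] exceeds 1, so [mu] is not a root of unity. *)
Lemma mu_expz_inj : injective (fun k : int => mu ^ k).
Proof.
have mu_pow (n : nat) : mu ^+ n = 1 -> n = 0%N.
  move/(congr1 Num.norm)/eqP; rewrite normrX normr1 distrC.
  rewrite -(natrB _ (leq_trans (isT : 0 < 3)%N r_ge3)).
  rewrite normr_nat -natrX pnatr_eq1 -(expn0 (#|X| - 1)).
  by rewrite eqn_exp2l => [/eqP//|]; rewrite ltn_subRL.
move=> a b /= eq_ab; apply/eqP; rewrite -subr_eq0; apply/eqP.
have : mu ^ (a - b) = 1.
  by rewrite expfzDr ?mu_neq0 // eq_ab -expfzDr ?mu_neq0 // subrr.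
case: (a - b) => n; first by rewrite -exprnP => /mu_pow->.
by rewrite NegzE -exprnN => /(congr1 GRing.inv); rewrite invrK invr1 => /mu_pow.
Qed.

Lemma comm_proj_eigenvector (t k : int) (v : 'cV[C]_N) :
    - D%:Z <= t <= D%:Z -> - D%:Z <= k <= D%:Z ->
    comm_mx_D C D x *m v = mu ^ k *: v ->
  comm_proj C D x t *m v = if k == t then v else 0.
Proof.
have ord_of (l : int) : - D%:Z <= l <= D%:Z ->
    exists i : 'I_(2 * D).+1, i%:Z - D%:Z = l.
  move=> lD; have lt_l : (absz (l + D%:Z)%R < (2 * D).+1)%N by lia.
  by exists (Ordinal lt_l) => /=; lia.
move=> /ord_of[i <-] /ord_of[j <-] gv.
pose U (l : 'I_(2 * D).+1) := comm_eigenspace C D x (l%:Z - D%:Z).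
have eqij (l m : 'I_(2 * D).+1) : (l%:Z - D%:Z == m%:Z - D%:Z) = (l == m).
  by rewrite (inj_eq (addIr _)) eqz_nat.
have vU : (v^T <= U j)%MS.
  by apply/eigenspaceP; rewrite -trmx_mul gv linearZ.
(* The eigenvalues are distinct, so the eigenspaces are independent and the projection along the
   others behaves as expected. *)
have dxU : (U i :&: (\sum_(l | l != i) U l) = 0)%MS.
  have dx : mxdirect (\sum_l U l).
    by apply: mxdirect_sum_eigenspace => l m _ _ /mu_expz_inj/eqP; rewrite eqij => /eqP.
  exact: (mxdirect_sumsP dx).
rewrite /comm_proj /cproj -[X in _ *m X]trmxK -trmx_mul.
rewrite (eq_bigl (fun l => l != i)) => [|l]; last by rewrite eqij.
rewrite eqij; case: eqVneq => [eq_ji|ne_ji].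
  by rewrite proj_mx_id ?trmxK // -eq_ji.
by rewrite proj_mx_0 ?trmx0 // (sumsmx_sup j).
Qed.

Lemma comm_basis_proj : exists2 v : (\dim W).-tuple 'cV[C]_N, basis_of W v &
  forall t : int, - D%:Z <= t <= D%:Z -> forall j : 'I_(\dim W),
    comm_proj C D x t *m v`_j
      = if (\dim W).-1%:Z - 2 * j%:Z == t then v`_j else 0.
Proof.
have [v Wv hv] := comm_basis; exists v => // t tD j.
have vn0 : v`_j != 0.
  by apply: (free_not0 (basis_free Wv)); rewrite mem_nth ?size_tuple.
have p_idem := comm_idemM ee ss ese ses q_neq1.
have sum_p := sum_comm_idem e s q_neq1.
have {}hv : derivmx D (\sum_j (comm_weight j)%:~R *: comm_idem e s q j) *m v`_j
    = ((\dim W).-1%:Z - 2 * j%:Z)%:~R *: v`_j.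
  by rewrite -comm_hE hv rmorphB rmorphM.
apply: comm_proj_eigenvector => //; last first.
  rewrite comm_mx_DE comm_siteE // invrK.
  exact: (tensmx_exp_derivmx p_idem sum_p mu_neq0 hv).
(* The weight is a sum of [D] terms among 1, -1 and 0, so it lies between [-D] and [D]. *)
have [phi /eqP] := derivmx_eigenvalue p_idem sum_p hv vn0.
rewrite eqr_int => /eqP->; rewrite -lter_norml.
apply: le_trans (ler_norm_sum _ _ _) _.
have -> : D%:Z = \sum_(k < D) 1 by rewrite sumr_const card_ord natz.
by apply: ler_sum => k _; case: (phi k) => [[]|].
Qed.

Lemma comm_proj_module (d : nat) (t : int) :
    module_diam x W = d -> - D%:Z <= t <= D%:Z ->
  (mximg (comm_proj C D x t) W <> 0%VS
     <-> (- d%:Z <= t <= d%:Z) /\ (2 %| d%:Z - t)%Z)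
  /\ (mximg (comm_proj C D x t) W <> 0%VS ->
      \dim (mximg (comm_proj C D x t) W) = 1%N).
Proof.
rewrite module_diamE => <- tD.
have [v Wv Fv] := comm_basis_proj; have {}Fv := Fv t tD.
have dimW : (0 < \dim W)%N by rewrite lt0n dimv_eq0; apply/eqP.
have weightP : (- (\dim W).-1%:Z <= t <= (\dim W).-1%:Z) /\ (2 %| (\dim W).-1%:Z - t)%Z
    <-> exists j : 'I_(\dim W), (\dim W).-1%:Z - 2 * j%:Z = t.
  split=> [[td /dvdzP[k def_k]] | [j <-]].
    (* The bounds on [t] place [k], half of [(\dim W).-1 - t], between 0 and [(\dim W).-1], so it
       indexes a basis vector. *)
    have ltk : (absz k < \dim W)%N by lia.
    have k_abs : (absz k)%:Z = k by lia.
    by exists (Ordinal ltk); rewrite k_abs mulrC -def_k opprB addrC subrK.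
  split; first by have := ltn_ord j; lia.
  by apply/dvdzP; exists j%:Z; rewrite opprB addrC subrK mulrC.
have [[j def_t]|no_j] : (exists j : 'I_(\dim W), (\dim W).-1%:Z - 2 * j%:Z = t)
    \/ ~ (exists j : 'I_(\dim W), (\dim W).-1%:Z - 2 * j%:Z = t).
- have [/existsP[j /eqP tj]|/existsPn no_j] :=
    boolP [exists j : 'I_(\dim W), (\dim W).-1%:Z - 2 * j%:Z == t].
    by left; exists j.
  by right=> -[j tj]; move: (no_j j); rewrite tj eqxx.
- have vn0 : v`_j != 0.
    by apply: (free_not0 (basis_free Wv)); rewrite mem_nth ?size_tuple.
  (* Exactly one basis vector has weight [t]: the projection fixes it and kills the others. *)
  have -> : mximg (comm_proj C D x t) W = <[v`_j]>%VS.
    apply/eqP; rewrite eqEsubv; apply/andP; split.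
      apply/subvP=> _ /mximgP[w Ww ->]; rewrite (coord_basis Wv Ww) mulmx_sumr.
      apply: rpred_sum => i _; rewrite -scalemxAr memvZ // Fv.
      case: eqP => [eq_i|_]; last exact: mem0v.
      suff -> : i = j by apply: memv_line.
      move: eq_i; rewrite -def_t => /addrI/oppr_inj/(mulfI (isT : (2 : int) != 0)).
      by move/eqP; rewrite eqz_nat => /eqP/val_inj.
    rewrite -memvE; have <- : comm_proj C D x t *m v`_j = v`_j by rewrite Fv def_t eqxx.
    by apply: mem_mximg; apply: (basis_mem Wv); rewrite mem_nth ?size_tuple.
  have line0 : <[v`_j]>%VS <> 0%VS by apply/eqP; rewrite -dimv_eq0 dim_vline vn0.
  by split=> [|_]; [split=> // _; apply/weightP; exists j | rewrite dim_vline vn0].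
have -> : mximg (comm_proj C D x t) W = 0%VS.
  apply/eqP; rewrite -subv0; apply/subvP=> _ /mximgP[w Ww ->].
  rewrite (coord_basis Wv Ww) mulmx_sumr; apply: rpred_sum => i _.
  rewrite -scalemxAr memvZ // Fv; case: eqP => [eq_i|_]; last exact: mem0v.
  by case: no_j; exists i.
by split=> //; split=> // /weightP.
Qed.

End IrreducibleModule.

Unset Implicit Arguments.

Theorem theorem36 (R : realType) (D r : nat) (X : finType) (x : X)
    (W : {vspace 'cV[R[i]]_#|vertex D X|}) (d : nat) (s : int) :
  (1 <= D)%N -> (3 <= r)%N -> #|X| = r ->
  irreducible_module (subconstituent_alg R[i] D x) W ->
  module_diam x W = d ->
  - D%:Z <= s <= D%:Z ->
  (mximg (comm_proj R[i] D x s) W <> 0%VS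
     <-> (- d%:Z <= s <= d%:Z) /\ (2 %| d%:Z - s)%Z)
  /\ (mximg (comm_proj R[i] D x s) W <> 0%VS ->
      \dim (mximg (comm_proj R[i] D x s) W) = 1%N).
Proof.
move=> D_gt0 + eq_r irrW diamW sD; rewrite -eq_r => r_ge3.
exact: comm_proj_module.
Qed.
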